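(* Let $X$ be a nondegenerate real random variable with $\mathbb{E}X^2<+\infty$. Let $b\in\mathbb{R}$, and let $\nu\neq0$ be a Lévy measure with $\int_{|u|>1}u^2\,\nu(du)<+\infty$. Define $$\eta(v)=\eta_+(v)\mathbf{1}_{(0,+\infty)}(v)+\eta_-(v)\mathbf{1}_{(-\infty,0)}(v),$$ where $\eta_+$ and $\eta_-$ are defined respectively on $(0,+\infty)$ and on $(-\infty,0)$ by $$\eta_+(v)=\int_{v}^{+\infty}u\,\nu(du),\qquad \eta_-(v)=\int_{-\infty}^{v}(-u)\,\nu(du),$$ and let $Y$ be a random variable independent of $X$ with law $$\mu_Y(du)=\frac{\eta(u)}{\int_{-\infty}^{+\infty}v^2\,\nu(dv)}\,du.$$ Then $$\mathrm{Cov}(X,f(X))=\left(\int_{-\infty}^{+\infty}u^2\,\nu(du)\right)\mathbb{E}f'(X+Y)$$ for all bounded Lipschitz functions $f:\mathbb{R}\to\mathbb{R}$ if and only if $X\sim ID(b,0,\nu)$.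
   Context: A Lévy measure is a positive Borel measure $\nu$ on $\mathbb{R}$ with $\nu(\{0\})=0$ and $\int(1\wedge u^2)\nu(du)<\infty$. $X\sim ID(b,0,\nu)$ means $\mathbb{E}e^{itX}=\exp\big(itb+\int_{-\infty}^{+\infty}(e^{itu}-1-itu\mathbf{1}_{|u|\le1})\nu(du)\big)$ for all $t\in\mathbb{R}$. For $f$ Lipschitz, $f'$ is defined Lebesgue-almost everywhere; $X+Y$ has an absolutely continuous law, so $f'(X+Y)$ is almost surely defined.
   Formalization: The covariance identity is unchanged when X is translated, so it cannot determine b and the ''only if'' is false as printed; the condition E X = b + ∫_{|u|>1} u ν(du) is added next to the covariance identity (and it is also proved in the ''if'' direction). *)

(* Defs.v *)
From HB Require Import structures.
From mathcomp Require Import all_boot all_order all_algebra.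
From mathcomp Require Import complex.
From mathcomp Require Import all_classical all_reals all_analysis.

Set Implicit Arguments.
Unset Strict Implicit.
Unset Printing Implicit Defensive.

Import Order.TTheory GRing.Theory Num.Theory.
Import numFieldNormedType.Exports.

Local Open Scope classical_set_scope.
Local Open Scope ring_scope.
Local Open Scope complex_scope.

Definition cexp (R : realType) (z : R[i]) : R[i] :=
  (expR (complex.Re z))%:C * (cos (complex.Im z) +i* sin (complex.Im z)).

(* The library only integrates real-valued functions, so a complex integral is
   taken componentwise. *)
Definition cintegral d (T : measurableType d) (R : realType)
    (mu : {measure set T -> \bar R}) (g : T -> R[i]) : R[i] :=
  (\int[mu]_x complex.Re (g x)) +i* (\int[mu]_x complex.Im (g x)).

Definition levy_measure (R : realType) (nu : {measure set R -> \bar R}) : Prop :=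
  nu [set 0] = 0%E /\ (\int[nu]_u (Num.min 1 (u ^+ 2))%:E < +oo)%E.

(* X ~ ID(b, 0, nu).  For a Levy measure nu the integrand below is nu-integrable,
   so the real-valued integral in [cintegral] is never a truncated infinity. *)
Definition is_ID d (T : measurableType d) (R : realType) (P : probability T R)
    (X : T -> R) (b : R) (nu : {measure set R -> \bar R}) : Prop :=
  forall t : R,
    cintegral P (fun w => cexp ('i * (t * X w)%:C)) =
    cexp ('i * (t * b)%:C +
          cintegral nu (fun u => cexp ('i * (t * u)%:C) - 1
            - 'i * (t * u * \1_[set v : R | `|v| <= 1] u)%:C)).

(* eta_plus is meant for 0 < v, eta_minus for v < 0; both integrals, as well as
   [second_moment], are finite when nu is a Levy measure with
   \int_{|u| > 1} u^2 nu(du) < +oo.  Including the endpoint v changes the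
   values only at the at most countably many atoms of nu. *)
Definition eta_plus (R : realType) (nu : {measure set R -> \bar R}) (v : R) : R :=
  \int[nu]_(u in `[v, +oo[) u.

Definition eta_minus (R : realType) (nu : {measure set R -> \bar R}) (v : R) : R :=
  \int[nu]_(u in `]-oo, v]) (- u).

Definition levy_eta (R : realType) (nu : {measure set R -> \bar R}) (v : R) : R :=
  eta_plus nu v * \1_(`]0, +oo[) v + eta_minus nu v * \1_(`]-oo, 0[) v.

Definition second_moment (R : realType) (nu : {measure set R -> \bar R}) : R :=
  \int[nu]_u (u ^+ 2).

Definition independent_RVs d (T : measurableType d) (R : realType)
    (P : probability T R) (X Y : {RV P >-> R}) : Prop :=
  forall A B : set R, measurable A -> measurable B ->
    P (X @^-1` A `&` Y @^-1` B) = (P (X @^-1` A) * P (Y @^-1` B))%E.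

Definition nondegenerate_RV d (T : measurableType d) (R : realType)
    (P : probability T R) (X : T -> R) : Prop :=
  forall c : R, ~ {ae P, forall w, X w = c}.

(* Main.v *)
(** Write m = E X, s = int u^2 nu(du), Z = X + Y, phi for the characteristic
    function of X and psi for the Levy exponent.  By Fubini, for the law of Y,
    s it E e^{itY} = int u (e^{itu} - 1) nu(du), so for f(x) = e^{itx} the
    covariance identity is the differential equation phi' = phi psi', provided
    that m = psi'(0)/i.  Its solution with phi(0) = 1 is phi = e^psi.

    Conversely phi = e^psi yields m = psi'(0)/i and the identity for all
    trigonometric polynomials.  To reach a bounded Lipschitz function f, replace
    f by f_r(x) = E f(r (2 K / n - 1)), with K binomial of parameters n = r^4
    and (1 + sin(x/r))/2.  This is a trigonometric polynomial bounded by sup |f|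
    whose derivative is bounded by the Lipschitz constant of f; moreover f_r
    tends to f everywhere and f_r' tends to f' wherever f is differentiable,
    that is, Lebesgue-almost everywhere.  As Z has an absolutely continuous law,
    dominated convergence concludes. *)

Require Import Defs.
From HB Require Import structures.
From mathcomp Require Import all_boot all_order all_algebra.
From mathcomp Require Import complex.
From mathcomp Require Import all_classical all_reals all_analysis.
From mathcomp Require Import measurable_realfun.
From mathcomp Require Import ring lra.
Set Implicit Arguments.
Unset Strict Implicit.
Unset Printing Implicit Defensive.
Import Order.TTheory GRing.Theory Num.Theory.
Import numFieldNormedType.Exports.

Local Open Scope classical_set_scope.
Local Open Scope ring_scope.

(** * Trigonometric polynomials and binomial averages *)

Lemma lipschitz_of_derive (R : realType) (f df : R -> R) (k : R) :
  (forall x : R, is_derive x 1 f (df x)) -> (forall x, `|df x| <= k) ->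
  forall x y, `|f x - f y| <= k * `|x - y|.
Proof.
move=> fdf dfk; suff H x y : x <= y -> `|f y - f x| <= k * `|y - x|.
  move=> x y; have [xy|/ltW yx] := leP x y; last exact: H.
  by rewrite distrC (distrC x); exact: H.
move=> xy.
have [|c _ ->] := @MVT_segment R f df x y xy (fun z _ => fdf z).
  apply: derivable_within_continuous => z _.
  by have [] := fdf z.
by rewrite normrM ler_wpM2r.
Qed.

Lemma norm_sinB_le (R : realType) (x y : R) : `|sin x - sin y| <= `|x - y|.
Proof.
rewrite -[leRHS]mul1r; apply: (@lipschitz_of_derive R sin cos) => // z.
by rewrite ler_norml cos_geN1 cos_le1.
Qed.

Lemma norm_cosB_le (R : realType) (x y : R) : `|cos x - cos y| <= `|x - y|.
Proof.
rewrite -[leRHS]mul1r; apply: (@lipschitz_of_derive R cos (fun z => - sin z)) => // z.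
by rewrite normrN ler_norml sin_geN1 sin_le1.
Qed.

Lemma norm_sin_le (R : realType) (x : R) : `|sin x| <= `|x|.
Proof. by have := norm_sinB_le x 0; rewrite sin0 !subr0. Qed.

Lemma norm_cosB1_le (R : realType) (x : R) : `|cos x - 1| <= `|x|.
Proof. by have := norm_cosB_le x 0; rewrite cos0 !subr0. Qed.

Lemma norm_sinBid_le (R : realType) (x : R) : `|sin x - x| <= x ^+ 2.
Proof.
suff H (y : R) : 0 <= y -> `|sin y - y| <= y ^+ 2.
  have [/H//|/ltW x0] := leP 0 x.
  have := H (- x); rewrite sinN oppr_ge0 sqrrN => /(_ x0).
  by rewrite -opprD normrN.
move=> y0; have dF (z : R) : is_derive z 1 (fun z : R => sin z - z) (cos z - 1).
  by apply: is_deriveB.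
have [|c] := @MVT_segment R _ _ 0 y y0 (fun z _ => dF z).
  by apply: derivable_within_continuous => z _; have [] := dF z.
rewrite in_itv /= => /andP[c0 cy]; rewrite sin0 !subr0 => ->.
rewrite normrM (ger0_norm y0) expr2 ler_wpM2r//.
by rewrite (le_trans (norm_cosB1_le c))// ger0_norm.
Qed.

Lemma norm_cosB1_le2 (R : realType) (x : R) : `|cos x - 1| <= x ^+ 2.
Proof.
have -> : x = x / 2 + x / 2 by field.
set y := x / 2.
rewrite cosD -!expr2 cos2sin2.
have -> : 1 - sin y ^+ 2 - sin y ^+ 2 - 1 = - (2 * sin y ^+ 2) by ring.
rewrite normrN (ger0_norm (mulr_ge0 (ler0n _ 2) (sqr_ge0 _))).
have : sin y ^+ 2 <= y ^+ 2 by rewrite -[leLHS]real_normK ?num_real// -[leRHS]real_normK ?num_real// ler_sqr ?nnegrE// norm_sin_le.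
nra.
Qed.

(* The expectation of g under the binomial law of parameters n and p. *)
Fixpoint bern (R : realType) (p : R) (n : nat) (g : nat -> R) : R :=
  if n is n'.+1 then p * bern p n' (g \o S) + (1 - p) * bern p n' g else g 0%N.

Section bern.
Variables (R : realType).
Implicit Types (p : R) (g h : nat -> R) (n : nat).

Lemma eq_bern p n g h : g =1 h -> bern p n g = bern p n h.
Proof.
elim: n g h => [|n IH] g h gh /=; first exact: gh.
by rewrite (IH _ _ gh) (IH (g \o S) (h \o S))// => k /=.
Qed.

Lemma bernD p n g h : bern p n (g \+ h) = bern p n g + bern p n h.
Proof.
elim: n g h => [//|n IH] g h /=.
by rewrite IH -[(g \+ h) \o S]/((g \o S) \+ (h \o S)) IH; ring.
Qed.

Lemma bernZ p n c g : bern p n (fun k => c * g k) = c * bern p n g.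
Proof.
elim: n g => [//|n IH] g /=.
by rewrite IH -[(fun k => c * g k) \o S]/(fun k => c * (g \o S) k) IH; ring.
Qed.

Lemma bernB p n g h :
  bern p n (fun k => g k - h k) = bern p n g - bern p n h.
Proof. by rewrite -mulN1r -bernZ -bernD; apply: eq_bern => k /=; ring. Qed.

Lemma bern_cst p n c : bern p n (fun=> c) = c.
Proof.
elim: n => [//|n IH] /=.
by rewrite -[(fun=> c) \o S]/(fun=> c) IH; ring.
Qed.

Lemma le_bern p n g h : 0 <= p <= 1 -> (forall k, g k <= h k) ->
  bern p n g <= bern p n h.
Proof.
move=> /andP[p0 p1]; elim: n g h => [|n IH] g h gh /=; first exact: gh.
by rewrite lerD// ler_wpM2l ?subr_ge0// IH// => k; exact: gh.
Qed.

Lemma norm_bern p n g : 0 <= p <= 1 -> `|bern p n g| <= bern p n (fun k => `|g k|).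
Proof.
move=> p01; rewrite ler_norml -mulN1r -bernZ; apply/andP; split.
  by apply: le_bern => // k; rewrite mulN1r; have := ler_norm (- g k); rewrite normrN lerNl.
by apply: le_bern => // k; exact: ler_norm.
Qed.

Lemma bern_mom1 p n c : bern p n (fun k => k%:R - c) = n%:R * p - c.
Proof.
elim: n c => [|n IH] c /=; first by rewrite mul0r.
have /eq_bern -> : (fun k => k%:R - c) \o S =1 (fun k : nat => k%:R - (c - 1)).
  by move=> k /=; rewrite -natr1; ring.
by rewrite !IH -natr1; ring.
Qed.

Lemma bern_mom2 p n c :
  bern p n (fun k => (k%:R - c) ^+ 2) = n%:R * p * (1 - p) + (n%:R * p - c) ^+ 2.
Proof.
elim: n c => [|n IH] c /=; first by ring.
have /eq_bern -> : (fun k => (k%:R - c) ^+ 2) \o S =1 (fun k : nat => (k%:R - (c - 1)) ^+ 2).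
  by move=> k /=; rewrite -natr1; ring.
by rewrite !IH -natr1; ring.
Qed.

Lemma bern_mom4 p n c :
  bern p n (fun k => (k%:R - c) ^+ 4) =
  n%:R * p * (1 - p) * (1 + 3 * (n%:R - 2) * p * (1 - p))
  + 4 * (n%:R * p * (1 - p) * (1 - 2 * p)) * (n%:R * p - c)
  + 6 * (n%:R * p * (1 - p)) * (n%:R * p - c) ^+ 2 + (n%:R * p - c) ^+ 4.
Proof.
elim: n c => [|n IH] c /=; first by ring.
have /eq_bern -> : (fun k => (k%:R - c) ^+ 4) \o S =1 (fun k : nat => (k%:R - (c - 1)) ^+ 4).
  by move=> k /=; rewrite -natr1; ring.
by rewrite !IH -natr1; ring.
Qed.

(* The score identity p (1 - p) d/dp E g(K) = E g(K) (K - n p). *)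
Lemma bern_cov p n g :
  bern p n.+1 (fun k => g k * (k%:R - n.+1%:R * p)) =
  p * (1 - p) * (n.+1%:R * bern p n (fun k => g k.+1 - g k)).
Proof.
elim: n g => [|n IH] g; first by rewrite /=; ring.
rewrite [LHS]/=.
have E1 : bern p n.+1 ((fun k => g k * (k%:R - n.+2%:R * p)) \o S) =
    bern p n.+1 (fun k => (g \o S) k * (k%:R - n.+1%:R * p)) + (1 - p) * bern p n.+1 (g \o S).
  rewrite -bernZ -bernD; apply: eq_bern => k /=.
  by rewrite -!natr1; ring.
have E2 : bern p n.+1 (fun k => g k * (k%:R - n.+2%:R * p)) =
    bern p n.+1 (fun k => g k * (k%:R - n.+1%:R * p)) + (- p) * bern p n.+1 g.
  rewrite -bernZ -bernD; apply: eq_bern => k /=.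
  by rewrite -!natr1; ring.
rewrite -[X in p * X + _]/(bern p n.+1 ((fun k => g k * (k%:R - n.+2%:R * p)) \o S)).
rewrite -[X in _ + _ * X]/(bern p n.+1 (fun k => g k * (k%:R - n.+2%:R * p))).
rewrite E1 E2 !IH.
have E4 : bern p n.+1 (g \o S) - bern p n.+1 g =
    p * bern p n (fun k => (g \o S) k.+1 - (g \o S) k) +
    (1 - p) * bern p n (fun k => g k.+1 - g k) by rewrite -bernB.
have -> : bern p n.+1 (fun k => g k.+1 - g k) = bern p n.+1 (g \o S) - bern p n.+1 g.
  by rewrite -bernB.
rewrite E4; move/eqP: E4; rewrite subr_eq => /eqP ->.
by rewrite -!natr1; ring.
Qed.

Lemma is_derive_bern (u : R -> R) (du x : R) n g : is_derive x 1 u du ->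
  is_derive x 1 (fun y => bern (u y) n g)
    (n%:R * bern (u x) n.-1 (fun k => g k.+1 - g k) * du).
Proof.
move=> udu; elim: n g => [|n IH] g.
  by rewrite !mul0r; exact: is_derive_cst.
have -> : (fun y => bern (u y) n.+1 g) =
  (u * (fun y => bern (u y) n (g \o S)) + (cst 1 - u) * (fun y => bern (u y) n g)).
  by apply/funext.
have D := is_deriveD (is_deriveM udu (IH (g \o S)))
  (is_deriveM (is_deriveB (is_derive_cst (1 : R) x 1) udu) (IH g)).
apply: (is_derive_eq D); rewrite /GRing.scale /= !fctE.
have -> : bern (u x) n (fun k => g k.+1 - g k) =
  bern (u x) n (g \o S) - bern (u x) n g by rewrite -bernB.
case: n {IH D} => [|n]; first by rewrite /=; ring.
rewrite [n.+1.-1]/= !bernB.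
rewrite [bern (u x) n.+1 (g \o S)]/= [bern (u x) n.+1 g]/=.
rewrite -!natr1.
rewrite -[bern (u x) n (fun k => g k.+1)]/(bern (u x) n (g \o S)).
rewrite -[bern (u x) n (fun k => (g \o S) k.+1)]/(bern (u x) n ((g \o S) \o S)).
by ring.
Qed.
End bern.

Inductive trigpoly (R : realType) : (R -> R) -> (R -> R) -> Prop :=
| trigpoly_cos (c t a : R) :
    trigpoly (fun x => c * cos (t * x + a)) (fun x => - (c * t) * sin (t * x + a))
| trigpolyD f df g dg : trigpoly f df -> trigpoly g dg ->
    trigpoly (f \+ g) (df \+ dg).

Section trigpoly.
Variable R : realType.
Implicit Types (f df g : R -> R) (c t a x : R).

Lemma is_derive_cos_affine t a x :
  is_derive x 1 (fun y => cos (t * y + a)) (- (t * sin (t * x + a))).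
Proof.
have H : is_derive x 1 (fun y : R => t * y + a) t.
  by apply: is_derive_eq; rewrite /GRing.scale /=; ring.
have := @is_derive1_comp R cos (fun y : R => t * y + a) x _ _ (is_derive_cos _) H.
by rewrite mulrC mulrN.
Qed.

Lemma trigpoly_is_derive f df : trigpoly f df -> forall x, is_derive x 1 f (df x).
Proof.
elim=> [c t a x|{}f {}df g dg _ IHf _ IHg x]; last exact: is_deriveD.
have H := is_derive_cos_affine t a x.
apply: is_derive_eq.
by rewrite /GRing.scale /=; ring.
Qed.

Lemma trigpoly_cosM t a f df : trigpoly f df ->
  exists dg, trigpoly (fun x => cos (t * x + a) * f x) dg.
Proof.
elim=> [c t' a'|{}f {}df g dg _ [d1 IHf] _ [d2 IHg]].
  eexists; rewrite (_ : (fun x => _) =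
    (fun x => (c / 2) * cos ((t + t') * x + (a + a'))) \+
    (fun x => (c / 2) * cos ((t - t') * x + (a - a')))).
    by apply: trigpolyD; apply: trigpoly_cos.
  apply/funext => x /=.
  rewrite (_ : (t + t') * x + (a + a') = (t * x + a) + (t' * x + a')); last by ring.
  rewrite (_ : (t - t') * x + (a - a') = (t * x + a) - (t' * x + a')); last by ring.
  set A := t * x + a; set B := t' * x + a'.
  by rewrite (cosB A B) (cosD A B); field.
exists (d1 \+ d2); rewrite (_ : (fun x => _) =
  (fun x => cos (t * x + a) * f x) \+ (fun x => cos (t * x + a) * g x)).
  exact: trigpolyD.
by apply/funext => x /=; ring.
Qed.

Lemma trigpolyZ c f df : trigpoly f df -> exists dg, trigpoly (fun x => c * f x) dg.
Proof.
elim=> [c' t' a'|{}f {}df g dg _ [d1 IHf] _ [d2 IHg]].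
  by eexists; under eq_fun do rewrite mulrA; apply: trigpoly_cos.
exists (d1 \+ d2); rewrite (_ : (fun x => _) =
  (fun x => c * f x) \+ (fun x => c * g x)); first exact: trigpolyD.
by apply/funext => x /=; ring.
Qed.

Lemma trigpoly_bern t n (g : nat -> R) : exists df,
  trigpoly (fun x => bern ((1 + sin (t * x)) / 2) n g) df.
Proof.
elim: n g => [|n IH] g.
  eexists; rewrite (_ : (fun x => _) = (fun x => g 0%N * cos (0 * x + 0))).
    exact: trigpoly_cos.
  by apply/funext => x; rewrite mul0r addr0 cos0 mulr1.
have [d1 H1] := IH (g \o S); have [d2 H2] := IH g.
have [k1 K1] := trigpolyZ (2^-1) (trigpolyD H1 H2).
have [e1 L1] := trigpolyZ (- 2^-1) H1; have [e2 L2] := trigpolyZ 2^-1 H2.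
have [k2 K2] := trigpoly_cosM t (pi / 2) (trigpolyD L1 L2).
exists (k1 \+ k2); move: (trigpolyD K1 K2); congr trigpoly.
by apply/funext => x /=; rewrite cosDpihalf; field.
Qed.
End trigpoly.

(** * Trigonometric approximation of bounded Lipschitz functions *)

Section trig_approx.
Variables (R : realType) (f : R -> R) (M L : R).
Hypothesis fM : forall x, `|f x| <= M.
Hypothesis fL : forall x y, `|f x - f y| <= L * `|x - y|.

Let node (r : R) (k : nat) : R := 2 / r ^+ 3 * k%:R - r.
Let prob (r x : R) : R := (1 + sin (r^-1 * x)) / 2.

Lemma prob01 (r x : R) : 0 <= prob r x <= 1.
Proof.
rewrite /prob; have := sin_geN1 (r^-1 * x); have := sin_le1 (r^-1 * x).
by move=> ? ?; apply/andP; split; lra.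
Qed.

Lemma is_derive_prob (r x : R) :
  is_derive x 1 (prob r) (cos (r^-1 * x) / (2 * r)).
Proof.
have H : is_derive x 1 (fun y : R => r^-1 * y) (r^-1).
  by apply: is_derive_eq; rewrite /GRing.scale /= mulr1.
have K := @is_derive1_comp R sin (fun y : R => r^-1 * y) x _ _ (is_derive_sin _) H.
rewrite /prob.
have -> : (fun x0 : R => (1 + sin (r^-1 * x0)) / 2) =
   (fun x0 => (1 + (sin \o (fun y : R => r^-1 * y)) x0) / 2) by [].
apply: is_derive_eq.
by rewrite /GRing.scale /= [(2 * r)^-1]invfM; ring.
Qed.

(* With r = i.+1 and r^4 trials, the nodes fluctuate around [r sin (x / r)] on the
   scale 1/r, which is not smaller than [|r sin (x / r) - x|] up to a constant;
   hence the derivatives converge as well, at each point where f has one. *)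
Definition trig_approx (i : nat) (x : R) : R :=
  bern (prob i.+1%:R x) (i.+1 ^ 4)%N (f \o node i.+1%:R).

Definition trig_approx' (i : nat) (x : R) : R :=
  (i.+1 ^ 4)%:R * bern (prob i.+1%:R x) (i.+1 ^ 4).-1
    (fun k => f (node i.+1%:R k.+1) - f (node i.+1%:R k)) *
  (cos (i.+1%:R^-1 * x) / (2 * i.+1%:R)).

Lemma is_derive_trig_approx i (x : R) :
  is_derive x 1 (trig_approx i) (trig_approx' i x).
Proof. exact/is_derive_bern/is_derive_prob. Qed.

Lemma trigpoly_trig_approx i : trigpoly (trig_approx i) (trig_approx' i).
Proof.
have [df H] := @trigpoly_bern R i.+1%:R^-1 (i.+1 ^ 4)%N (f \o node i.+1%:R).
suff <- : df = trig_approx' i by [].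
apply/funext => x.
have [_ <-] := trigpoly_is_derive H x.
by have [_ <-] := is_derive_trig_approx i x.
Qed.

Lemma norm_trig_approx_le i (x : R) : `|trig_approx i x| <= M.
Proof.
rewrite (le_trans (norm_bern _ _ (prob01 _ _)))//.
by rewrite -[leRHS](bern_cst (prob i.+1%:R x) (i.+1 ^ 4)%N); apply: le_bern => [|k]; [exact: prob01|exact: fM].
Qed.

Lemma norm_trig_approx'_le i (x : R) : `|trig_approx' i x| <= L.
Proof.
rewrite /trig_approx'; set r : R := i.+1%:R.
have r0 : 0 < r by rewrite ltr0n.
rewrite natrX -/r !normrM.
set B := bern _ _ _; have HB : `|B| <= L * (2 / r ^+ 3).
  rewrite (le_trans (norm_bern _ _ (prob01 _ _)))//.
  rewrite -[leRHS](bern_cst (prob r x) (i.+1 ^ 4).-1); apply: le_bern => [|k].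
    exact: prob01.
  rewrite (le_trans (fL _ _))// /node -[k.+1%:R]natr1.
  have -> : 2 / r ^+ 3 * (k%:R + 1) - r - (2 / r ^+ 3 * k%:R - r) = 2 / r ^+ 3 by ring.
  by rewrite ger0_norm// divr_ge0// exprn_ge0// ltW.
have cr : `|cos (r^-1 * x)| <= 1 by rewrite ler_norml cos_geN1 cos_le1.
rewrite ger0_norm ?exprn_ge0 ?(ltW r0)//.
rewrite [`|(2 * r)^-1|]ger0_norm ?invr_ge0 ?mulr_ge0 ?(ltW r0)//.
apply: (@le_trans _ _ (r ^+ 4 * (L * (2 / r ^+ 3)) * (1 * (2 * r)^-1))).
  have r4 : 0 <= r ^+ 4 by rewrite exprn_ge0 ?(ltW r0).
  have r2 : 0 <= (2 * r)^-1 by rewrite invr_ge0 mulr_ge0 ?(ltW r0).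
  apply: ler_pM; [exact: mulr_ge0|exact: mulr_ge0|exact: ler_wpM2l|exact: ler_wpM2r].
rewrite le_eqVlt; apply/orP; left; apply/eqP.
by field; rewrite gt_eqF.
Qed.

Let dev (i : nat) (x : R) (k : nat) : R := k%:R - (i.+1 ^ 4)%:R * prob i.+1%:R x.

Lemma bern_dev0 i (x : R) : bern (prob i.+1%:R x) (i.+1 ^ 4)%N (dev i x) = 0.
Proof. by rewrite bern_mom1 subrr. Qed.

Lemma bern_dev2 i (x : R) : bern (prob i.+1%:R x) (i.+1 ^ 4)%N (fun k => dev i x k ^+ 2) =
  i.+1%:R ^+ 4 * (prob i.+1%:R x * (1 - prob i.+1%:R x)).
Proof. by rewrite bern_mom2 subrr expr0n addr0 natrX mulrA. Qed.

Lemma prob_var i (x : R) : 0 <= prob i.+1%:R x * (1 - prob i.+1%:R x) <= 1 / 4.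
Proof.
have /andP[p0 p1] := prob01 i.+1%:R x; set p := prob _ _ in p0 p1 *.
rewrite mulr_ge0 ?subr_ge0//=.
have := sqr_ge0 (p - 1 / 2); rewrite expr2; lra.
Qed.

Lemma bern_dev4 i (x : R) : bern (prob i.+1%:R x) (i.+1 ^ 4)%N (fun k => dev i x k ^+ 4) <=
  i.+1%:R ^+ 8.
Proof.
rewrite bern_mom4 subrr !expr0n /= !mulr0 !addr0 natrX.
have -> : i.+1%:R ^+ 8 = (i.+1%:R ^+ 4) ^+ 2 :> R by rewrite -exprM.
have : 1 <= i.+1%:R ^+ 4 :> R by rewrite -natrX ler1n expn_gt0.
move: (i.+1%:R ^+ 4) => n n1.
have /andP[v0 v1] := prob_var i x.
have -> (p : R) : n * p * (1 - p) * (1 + 3 * (n - 2) * p * (1 - p)) =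
  n * ((p * (1 - p)) + 3 * (n - 2) * (p * (1 - p)) ^+ 2) by ring.
set v := (_ * _) in v0 v1 *.
rewrite expr2 ler_wpM2l//; first by lra.
have v2 : v ^+ 2 <= 1 / 16 by rewrite expr2; nra.
have v20 : 0 <= v ^+ 2 by exact: sqr_ge0.
nra.
Qed.

Lemma bern_norm_dev i (x : R) :
  bern (prob i.+1%:R x) (i.+1 ^ 4)%N (fun k => `|dev i x k|) <= i.+1%:R ^+ 2.
Proof.
set r : R := i.+1%:R; have r0 : 0 < r by rewrite ltr0n.
have r20 : 0 < r ^+ 2 by rewrite exprn_gt0.
apply: (@le_trans _ _ (bern (prob r x) (i.+1 ^ 4)
    ((fun k => (2 * r ^+ 2)^-1 * dev i x k ^+ 2) \+ (fun=> r ^+ 2 / 2)))).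
  apply: le_bern => [|k /=]; first exact: prob01.
  have E : dev i x k ^+ 2 = `|dev i x k| ^+ 2 by rewrite real_normK ?num_real.
  rewrite E; have := sqr_ge0 (`|dev i x k| - r ^+ 2); set D := `|_|.
  have -> : (2 * r ^+ 2)^-1 * D ^+ 2 + r ^+ 2 / 2 = (D ^+ 2 + (r ^+ 2) ^+ 2) / (2 * r ^+ 2).
    by field; rewrite gt_eqF.
  rewrite ler_pdivlMr ?mulr_gt0// !expr2; lra.
rewrite bernD bern_cst bernZ bern_dev2 -/r.
have /andP[v0 v1] := prob_var i x; rewrite -/r in v0 v1.
set v := (_ * _) in v0 v1 *.
have -> : (2 * r ^+ 2)^-1 * (r ^+ 4 * v) = r ^+ 2 * v / 2 by field; rewrite gt_eqF.
nra.
Qed.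

Let err (r x : R) : R := r * sin (r^-1 * x) - x.

Lemma node_dev i (x : R) k :
  node i.+1%:R k - x = 2 / i.+1%:R ^+ 3 * dev i x k + err i.+1%:R x.
Proof.
rewrite /node /dev /err /prob natrX; have : 0 < i.+1%:R :> R by rewrite ltr0n.
by move: i.+1%:R => r r0; field; rewrite gt_eqF.
Qed.

Lemma norm_err_le i (x : R) : `|err i.+1%:R x| <= x ^+ 2 / i.+1%:R.
Proof.
rewrite /err; set r : R := i.+1%:R; have r0 : 0 < r by rewrite ltr0n.
have -> : r * sin (r^-1 * x) - x = r * (sin (r^-1 * x) - r^-1 * x) by field; rewrite gt_eqF.
rewrite normrM gtr0_norm// (le_trans (ler_wpM2l (ltW r0) (norm_sinBid_le _)))//.
rewrite le_eqVlt; apply/orP; left; apply/eqP.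
by field; rewrite gt_eqF.
Qed.

Lemma trig_approx_err i (x : R) :
  `|trig_approx i x - f x| <= L * ((2 + x ^+ 2) / i.+1%:R).
Proof.
have L0 : 0 <= L.
  by have := fL 0 1; rewrite sub0r normrN1 mulr1; exact: le_trans.
rewrite /trig_approx; set r : R := i.+1%:R; have r0 : 0 < r by rewrite ltr0n.
rewrite -[f x](bern_cst (prob r x) (i.+1 ^ 4)%N) -bernB.
rewrite (le_trans (norm_bern _ _ (prob01 _ _)))//.
apply: (@le_trans _ _ (bern (prob r x) (i.+1 ^ 4)
    ((fun k => (L * (2 / r ^+ 3)) * `|dev i x k|) \+ (fun=> L * (x ^+ 2 / r))))).
  apply: le_bern => [|k /=]; first exact: prob01.
  rewrite (le_trans (fL _ _))// node_dev.
  rewrite [leRHS](_ : _ = L * (2 / r ^+ 3 * `|dev i x k| + x ^+ 2 / r)); last by ring.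
  rewrite ler_wpM2l//.
  rewrite (le_trans (ler_normD _ _))// lerD ?norm_err_le//.
  by rewrite normrM ger0_norm// divr_ge0 ?exprn_ge0// ltW.
rewrite bernD bern_cst bernZ.
apply: (@le_trans _ _ (L * (2 / r ^+ 3) * r ^+ 2 + L * (x ^+ 2 / r))).
  rewrite lerD2r ler_wpM2l ?bern_norm_dev// mulr_ge0// divr_ge0 ?exprn_ge0// ltW//.
rewrite le_eqVlt; apply/orP; left; apply/eqP.
by field; rewrite gt_eqF.
Qed.

Lemma trig_approx'_err i (x a e K : R) : 0 <= e -> 0 <= K ->
  2 * x ^+ 2 <= i.+1%:R ^+ 2 ->
  (forall y, `|f y - f x - a * (y - x)| <= e * `|y - x| + K * `|y - x| ^+ 3) ->
  `|trig_approx' i x - cos (i.+1%:R^-1 * x) * a| <=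
  4 * (e * (1 + x ^+ 2) + 4 * K * (8 + x ^+ 6) / i.+1%:R ^+ 2).
Proof.
move=> e0 K0 xr fxy; rewrite /trig_approx'.
set r : R := i.+1%:R; have r0 : 0 < r by rewrite ltr0n.
set p := prob r x; set c := cos _; set n := (i.+1 ^ 4)%N.
have rn : n%:R = r ^+ 4 by rewrite natrX.
have n0 : (0 < n)%N by rewrite expn_gt0.
have pq : 1 / 8 <= p * (1 - p).
  rewrite /p /prob.
  have -> : (1 + sin (r^-1 * x)) / 2 * (1 - (1 + sin (r^-1 * x)) / 2) =
     (1 - sin (r^-1 * x) ^+ 2) / 4 by field.
  have : sin (r^-1 * x) ^+ 2 <= (r^-1 * x) ^+ 2.
    rewrite -[leLHS]real_normK ?num_real// -[leRHS]real_normK ?num_real//.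
    by rewrite ler_sqr ?nnegrE// norm_sin_le.
  have : (r^-1 * x) ^+ 2 <= 1 / 2.
    rewrite exprMn exprVn ler_pdivrMl ?exprn_gt0// -/r in xr *.
    lra.
  move: (sin _ ^+ 2) ((r^-1 * x) ^+ 2) => s2 y2; lra.
have pq0 : 0 < p * (1 - p) by lra.
pose rem k := f (node r k) - f x - a * (node r k - x).
have cov := bern_cov p n.-1 (f \o node r).
rewrite prednK// in cov.
have main : bern p n (fun k => f (node r k) * dev i x k) =
    a * (2 * r) * (p * (1 - p)) + bern p n (fun k => rem k * dev i x k).
  rewrite (_ : bern p n (fun k => _) = bern p n
    ((fun k => (f x + a * err r x) * dev i x k) \+
    ((fun k => a * (2 / r ^+ 3) * dev i x k ^+ 2) \+ (fun k => rem k * dev i x k)))).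
    rewrite !bernD !bernZ bern_dev0 bern_dev2 -/r -/p mulr0 add0r.
    by congr (_ + _); field; rewrite gt_eqF.
  apply: eq_bern => k /=; rewrite /rem.
  have E := node_dev i x k; rewrite -/r in E.
  have -> : f (node r k) = (f (node r k) - f x - a * (node r k - x)) + f x + a * (node r k - x).
    by ring.
  set w := _ - _ - _.
  have -> : w + f x + a * (node r k - x) - f x - a * (node r k - x) = w by ring.
  by rewrite E; ring.
have -> : n%:R * bern p n.-1 (fun k => f (node r k.+1) - f (node r k)) * (c / (2 * r)) - c * a
  = c * (bern p n (fun k => rem k * dev i x k) / (2 * r * (p * (1 - p)))).
  have -> : n%:R * bern p n.-1 (fun k => f (node r k.+1) - f (node r k)) =
     bern p n (fun k => f (node r k) * dev i x k) / (p * (1 - p)).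
    have -> : bern p n (fun k => f (node r k) * dev i x k) = p * (1 - p) *
      (n%:R * bern p n.-1 (fun k => f (node r k.+1) - f (node r k))) by exact: cov.
    by rewrite mulrAC divff ?mul1r// gt_eqF.
  rewrite main; move: (bern _ _ _) => B.
  move: (p * (1 - p)) pq0 {pq} => v v0.
  by field; rewrite !gt_eqF.
have hrem k : `|rem k * dev i x k| <=
   e * (2 / r ^+ 3) * dev i x k ^+ 2 + ((e * (x ^+ 2 / r) + 4 * K * (x ^+ 2 / r) ^+ 3) * `|dev i x k| +
   4 * K * (2 / r ^+ 3) ^+ 3 * dev i x k ^+ 4).
  have -> : dev i x k ^+ 4 = `|dev i x k| ^+ 4.
    by rewrite -normrX ger0_norm// exprn_even_ge0.
  have -> : dev i x k ^+ 2 = `|dev i x k| ^+ 2 by rewrite real_normK ?num_real.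
  have A := fxy (node r k); rewrite -/(rem k) in A.
  rewrite normrM; set D := `|dev i x k|; have D0 : 0 <= D by exact: normr_ge0.
  have B : `|node r k - x| <= 2 / r ^+ 3 * D + x ^+ 2 / r.
    rewrite node_dev (le_trans (ler_normD _ _))// lerD ?norm_err_le//.
    by rewrite normrM ger0_norm// divr_ge0 ?exprn_ge0// ltW.
  set al := 2 / r ^+ 3 * D in B; set be := x ^+ 2 / r in B *.
  have al0 : 0 <= al by rewrite mulr_ge0// divr_ge0 ?exprn_ge0// ltW.
  have be0 : 0 <= be by rewrite divr_ge0 ?sqr_ge0// ltW.
  have cube : (al + be) ^+ 3 <= 4 * (al ^+ 3 + be ^+ 3).
    have -> : 4 * (al ^+ 3 + be ^+ 3) = (al + be) ^+ 3 + 3 * ((al + be) * (al - be) ^+ 2) by ring.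
    by rewrite lerDl mulr_ge0// mulr_ge0 ?sqr_ge0// addr_ge0.
  have C : `|rem k| <= e * (al + be) + K * (4 * (al ^+ 3 + be ^+ 3)).
    apply: (le_trans A); rewrite lerD ?ler_wpM2l//.
    apply: le_trans cube; rewrite ler_pXn2r ?nnegrE ?addr_ge0//.
  apply: (le_trans (ler_wpM2r D0 C)); rewrite /al le_eqVlt; apply/orP; left; apply/eqP.
  by ring.
have {hrem} hB : `|bern p n (fun k => rem k * dev i x k)| <=
   e * (2 / r ^+ 3) * (r ^+ 4 / 4) + ((e * (x ^+ 2 / r) + 4 * K * (x ^+ 2 / r) ^+ 3) * r ^+ 2 +
   4 * K * (2 / r ^+ 3) ^+ 3 * r ^+ 8).
  rewrite (le_trans (norm_bern _ _ (prob01 _ _)))//.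
  apply: (le_trans (le_bern _ (prob01 _ _) hrem)).
  rewrite (_ : bern _ _ _ = bern p n
    ((fun k => e * (2 / r ^+ 3) * dev i x k ^+ 2) \+
     ((fun k => (e * (x ^+ 2 / r) + 4 * K * (x ^+ 2 / r) ^+ 3) * `|dev i x k|) \+
      (fun k => 4 * K * (2 / r ^+ 3) ^+ 3 * dev i x k ^+ 4))))//.
  rewrite 2!bernD 3!bernZ.
  have r3 : 0 <= 2 / r ^+ 3 by rewrite divr_ge0 ?exprn_ge0// ltW.
  have x2r : 0 <= x ^+ 2 / r by rewrite divr_ge0 ?sqr_ge0// ltW.
  apply: lerD; last apply: lerD.
  - apply: (ler_wpM2l (mulr_ge0 e0 r3)); rewrite [leLHS](bern_dev2 i x) -/r -/p ler_wpM2l ?exprn_ge0 ?(ltW r0)//.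
    by have /andP[_] := prob_var i x; rewrite div1r.
  - apply: ler_wpM2l (bern_norm_dev i x).
    exact: addr_ge0 (mulr_ge0 e0 x2r) (mulr_ge0 (mulr_ge0 (ler0n _ 4) K0) (exprn_ge0 _ x2r)).
  - apply: ler_wpM2l (bern_dev4 i x).
    exact: mulr_ge0 (mulr_ge0 (ler0n _ 4) K0) (exprn_ge0 _ r3).
rewrite normrM normf_div (gtr0_norm (mulr_gt0 (mulr_gt0 (ltr0n _ 2) r0) pq0)).
have c1 : `|c| <= 1 by rewrite ler_norml cos_geN1 cos_le1.
apply: (@le_trans _ _ (1 * (`|bern p n (fun k => rem k * dev i x k)| / (r / 4)))).
  apply: ler_pM => //; first exact: divr_ge0 (normr_ge0 _) (ltW (mulr_gt0 (mulr_gt0 (ltr0n _ 2) r0) pq0)).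
  rewrite ler_wpM2l// lef_pV2 ?posrE; [|exact: mulr_gt0 (mulr_gt0 (ltr0n _ 2) r0) pq0|by rewrite divr_gt0].
  move: (p * (1 - p)) pq => v v8; nra.
rewrite mul1r ler_pdivrMr ?divr_gt0//; apply: (le_trans hB).
have -> : e * (2 / r ^+ 3) * (r ^+ 4 / 4) + ((e * (x ^+ 2 / r) + 4 * K * (x ^+ 2 / r) ^+ 3) * r ^+ 2 +
   4 * K * (2 / r ^+ 3) ^+ 3 * r ^+ 8) =
   r * (e * (1 / 2 + x ^+ 2) + 4 * K * (8 + x ^+ 6) / r ^+ 2) by field; rewrite gt_eqF.
have -> : 4 * (e * (1 + x ^+ 2) + 4 * K * (8 + x ^+ 6) / r ^+ 2) * (r / 4) =
   r * (e * (1 + x ^+ 2) + 4 * K * (8 + x ^+ 6) / r ^+ 2) by field; rewrite gt_eqF.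
by rewrite ler_wpM2l ?(ltW r0)// lerD2r ler_wpM2l// lerD2r; lra.
Qed.

Let cvg_natinv (c : R) : c / i.+1%:R @[i --> \oo] --> 0.
Proof. by rewrite -[X in _ --> X](mulr0 c); apply: cvgMr => //; exact: cvg_harmonic. Qed.

Lemma cvg_trig_approx (x : R) : trig_approx i x @[i --> \oo] --> f x.
Proof.
apply/cvgrPdist_le => e e0.
have /cvgrPdist_le/(_ e e0) := cvg_natinv (L * (2 + x ^+ 2)).
apply: filterS => i; rewrite sub0r normrN distrC => H.
apply: (le_trans (trig_approx_err i x)); apply: le_trans H.
by rewrite mulrA ler_norm.
Qed.

Lemma cvg_trig_approx' (x a : R) : is_derive x 1 f a ->
  trig_approx' i x @[i --> \oo] --> a.
Proof.
move=> fa.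
have L0 : 0 <= L.
  by have := fL 0 1; rewrite sub0r normrN1 mulr1; exact: le_trans.
have rem0 (e : R) : 0 < e -> exists2 K, 0 <= K & forall y,
    `|f y - f x - a * (y - x)| <= e * `|y - x| + K * `|y - x| ^+ 3.
  move=> e0; have [df Df] := fa.
  have : h^-1 *: (f (h *: 1 + x) - f x) @[h --> 0^'] --> a by rewrite -Df.
  move/cvgrPdist_le => /(_ e e0) [d /= d0 dH].
  exists ((L + `|a|) / d ^+ 2) => [|y].
    by rewrite divr_ge0 ?addr_ge0// exprn_ge0// ltW.
  have [->|yx] := eqVneq y x.
    by rewrite !subrr mulr0 subr0 normr0 expr0n !mulr0 addr0.
  have yx0 : 0 < `|y - x| by rewrite normr_gt0 subr_eq0.
  have [yd|dy] := ltP `|y - x| d.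
    have := dH (y - x); rewrite /ball /= sub0r normrN subr_eq0 => /(_ yd yx).
    rewrite /GRing.scale /= mulr1 subrK => H.
    rewrite (_ : f y - f x - a * (y - x) = - ((a - (y - x)^-1 * (f y - f x)) * (y - x))); last first.
      by field; rewrite subr_eq0.
    rewrite normrN normrM ler_wpDr//; last by rewrite ler_wpM2r.
    by rewrite mulr_ge0 ?exprn_ge0// divr_ge0 ?addr_ge0// exprn_ge0// ltW.
  rewrite ler_wpDl ?mulr_ge0 ?(ltW e0)//.
  apply: (@le_trans _ _ ((L + `|a|) * `|y - x|)).
    by rewrite (le_trans (ler_normB _ _))// mulrDl lerD ?fL// normrM.
  rewrite -mulrA ler_wpM2l ?addr_ge0// ler_pdivlMl ?exprn_gt0//.
  by rewrite [leRHS]exprSr ler_wpM2r// ler_pXn2r ?nnegrE// ltW.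
suff H : trig_approx' i x - cos (i.+1%:R^-1 * x) * a @[i --> \oo] --> 0.
  have C0 : cos (i.+1%:R^-1 * x) @[i --> \oo] --> cos (0 : R).
    apply: (@continuous_cvg _ _ _ _ _ _ (@cos R)); first exact: continuous_cos.
    by under eq_fun do rewrite mulrC; exact: (cvg_natinv x).
  have C : cos (i.+1%:R^-1 * x) * a @[i --> \oo] --> a.
    by rewrite -[X in _ --> X](_ : cos 0 * a = _); [exact: cvgMl|rewrite cos0 mul1r].
  rewrite -[X in _ --> X]add0r.
  have -> : (fun i => trig_approx' i x) = (fun i =>
      trig_approx' i x - cos (i.+1%:R^-1 * x) * a + cos (i.+1%:R^-1 * x) * a).
    by apply/funext => i; rewrite subrK.
  exact: cvgD H C.
apply/cvgrPdist_le => e e0.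
have x1 : 0 < 1 + x ^+ 2 by rewrite ltr_wpDr ?sqr_ge0.
have e1 : 0 < e / (8 * (1 + x ^+ 2)) by rewrite divr_gt0// mulr_gt0.
have [K K0 hK] := rem0 _ e1.
pose c := 16 * K * (8 + x ^+ 6).
have c0 : 0 <= c by rewrite !mulr_ge0// addr_ge0// exprn_even_ge0.
near=> i; rewrite sub0r normrN.
have r0 : 0 < i.+1%:R :> R by rewrite ltr0n.
have r1 : 1 <= i.+1%:R :> R by rewrite ler1n.
apply: (le_trans (trig_approx'_err (ltW e1) K0 _ hK)).
  have : 2 * x ^+ 2 <= i%:R by near: i; exact: nbhs_infty_ger.
  move=> /le_trans; apply; rewrite -natrX ler_nat.
  by rewrite (leq_trans (leqnSn i))// -mulnn leq_pmulr.
rewrite mulrDr.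
have -> : 4 * (e / (8 * (1 + x ^+ 2)) * (1 + x ^+ 2)) = e / 2.
  by field; rewrite gt_eqF.
rewrite [leRHS](splitr e) lerD2l.
have -> : 4 * (4 * K * (8 + x ^+ 6) / i.+1%:R ^+ 2) = c / i.+1%:R / i.+1%:R.
  by rewrite /c; move: i.+1%:R r0 => r r0; field; rewrite gt_eqF.
have : `|c / i.+1%:R| <= e / 2.
  near: i; have e2 : 0 < e / 2 by rewrite divr_gt0.
  have /cvgrPdist_le/(_ _ e2) := cvg_natinv c.
  by apply: filterS => i; rewrite sub0r normrN.
rewrite ger0_norm; last by rewrite divr_ge0// ltW.
apply: le_trans; rewrite ler_pdivrMr// ler_peMr// divr_ge0// ltW//.
Unshelve. all: by end_near.
Qed.
End trig_approx.

(** * Almost everywhere differentiability of Lipschitz functions *)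

Lemma continuous_lipschitz (R : realType) (f : R -> R) (L : R) :
  (forall x y, `|f x - f y| <= L * `|x - y|) -> continuous f.
Proof.
move=> fL x; apply/cvgrPdist_le => e e0; near=> y.
have c0 : 0 < `|L| + 1 by rewrite ltr_wpDl.
rewrite (le_trans (fL _ _))// (@le_trans _ _ ((`|L| + 1) * `|x - y|))//.
  by rewrite ler_wpM2r// (le_trans (ler_norm L))// lerDl.
rewrite -ler_pdivlMl//.
by near: y; apply: cvgr_dist_le => //; rewrite mulr_gt0 ?invr_gt0.
Unshelve. all: by end_near.
Qed.

Section rademacher.
Variable R : realType.
Local Notation mu := (@lebesgue_measure R).

Lemma lebesgue_stieltjes_measure_oc (g : cumulative R R) (a b : R) : a <= b ->
  lebesgue_stieltjes_measure g `]a, b] = (g b - g a)%:E.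
Proof.
move=> ab; rewrite /lebesgue_stieltjes_measure /measure_extension.
by rewrite measurable_mu_extE/= ?wlength_itv_bnd//; exact: is_ocitv.
Qed.

(* The Stieltjes measures of g and h add up to Lebesgue measure. *)
Lemma null_dominates_stieltjes (g h : cumulative R R) :
  (forall x y : R, g x - g y + (h x - h y) = x - y) ->
  forall A, measurable A -> mu A = 0%E -> lebesgue_stieltjes_measure g A = 0%E.
Proof.
move=> gh A mA A0.
have E := @lebesgue_measure_unique R (measure_add (lebesgue_stieltjes_measure g)
   (lebesgue_stieltjes_measure h)).
have {}E : lebesgue_measure A = measure_add (lebesgue_stieltjes_measure g)
   (lebesgue_stieltjes_measure h) A.
  apply: E => // X /ocitvP [->|[[a b] /= /ltW ab ->]]; first by rewrite !measure0.
  transitivity ((g b - g a)%:E + (h b - h a)%:E)%E; last first.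
    by rewrite -!lebesgue_stieltjes_measure_oc// [RHS]measure_addE.
  rewrite -EFinD gh.
  rewrite lebesgue_measure_itv/= lte_fin.
  by move: ab; rewrite le_eqVlt => /orP[/eqP ->|->//]; rewrite ltxx subrr.
move: E; rewrite [LHS]A0 [RHS]measure_addE => /esym/eqP.
by rewrite padde_eq0// => /andP[/eqP ->].
Qed.

Lemma ae_derivable_stieltjes (g h : cumulative R R) :
  (forall x y : R, g x - g y + (h x - h y) = x - y) ->
  {ae mu, forall x, derivable (g : R -> R) x 1}.
Proof.
move=> gh.
suff H n : {ae mu, forall x : R, - n%:R < x < n%:R -> derivable (g : R -> R) x 1}.
  have := @ae_foralln _ _ _ mu _ H; apply: filterS => x Hx.
  have [n xn] : exists n : nat, `|x| < n%:R.
    by exists (Num.truncn `|x|).+1; exact: truncnS_gt.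
  by apply: (Hx n); rewrite -ltr_norml.
pose D : set (measurableTypeR R) := `]- n%:R, n%:R]%classic.
have mD : measurable D by exact: measurable_itv.
pose nu0 := mrestr (lebesgue_stieltjes_measure g) mD.
have nu0fin : fin_num_fun nu0.
  move=> A mA; rewrite ge0_fin_numE//; apply: (@le_lt_trans _ _ (nu0 setT)).
    by apply: le_measure => //; rewrite inE.
  rewrite /nu0 /mrestr setTI lebesgue_stieltjes_measure_oc ?ltry//.
  by rewrite -subr_ge0 opprK addr_ge0.
pose nu : {finite_measure set (measurableTypeR R) -> \bar R} :=
  HB.pack nu0 (Measure_isFinite.Build _ _ _ nu0 nu0fin).
have numu : nu `<< mu.
  apply/null_content_dominatesP => A mA A0.
  rewrite /= /nu0 /mrestr; apply: (null_dominates_stieltjes gh).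
    exact: measurableI.
  by apply: (@subset_measure0 _ _ _ mu (A `&` D) A) => //; exact: measurableI.
pose d := fine \o Radon_Nikodym_SigmaFinite.f nu mu.
have dE : EFin \o d = Radon_Nikodym_SigmaFinite.f nu mu.
  by apply/funext => x /=; rewrite fineK// Radon_Nikodym_SigmaFinite.f_fin_num.
have intd : mu.-integrable setT (EFin \o d).
  by rewrite dE; exact: Radon_Nikodym_SigmaFinite.f_integrable.
have intdy (y : R) : mu.-integrable `]-oo, y]%classic (EFin \o (d : R -> R)).
  by apply: (integrableS measurableT) intd.
have := @FTC1Ny R d intdy (open_integrable_locally openT intd).
apply: filterS; first exact: (ae_filter_ringOfSetsType mu).
move=> x [+ _] /andP[nx xn].
set F := fun x => _ => dF.
have FE y : - n%:R < y <= n%:R -> F y = g y - g (- n%:R).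
  move=> /andP[ny yn]; rewrite /F /Rintegral.
  have -> : (\int[mu]_(t in `]-oo, y]) (d t)%:E)%E = nu `]-oo, y]%classic.
    rewrite (Radon_Nikodym_SigmaFinite.f_integral numu); last exact: measurable_itv.
    by rewrite -dE.
  rewrite /= /nu0 /mrestr.
  have -> : `]-oo, y]%classic `&` D = `]- n%:R, y]%classic.
    apply/seteqP; split => z /=; rewrite /D /= !in_itv /=.
      by move=> [zy /andP[-> _]].
    by move=> /andP[nz zy]; split => //; rewrite nz (le_trans zy).
  by rewrite lebesgue_stieltjes_measure_oc// ltW.
have dF' : derivable (F \+ cst (g (- n%:R))) x 1 by apply: derivableD dF (@derivable_cst _ _ _ _ _ _).
apply: near_eq_derivable dF'.
near=> y; rewrite /= FE ?subrK//.
have : y \in `]- n%:R, n%:R[ by near: y; apply: near_in_itvoo; rewrite in_itv /= nx.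
by rewrite in_itv /= => /andP[-> /ltW].
Unshelve. all: by end_near.
Qed.

Lemma ae_derivable_lipschitz (f : R -> R) (L : R) :
  (forall x y, `|f x - f y| <= L * `|x - y|) ->
  {ae mu, forall x, derivable f x 1}.
Proof.
move=> fL; pose c := `|L| + 1.
have c0 : 0 < c by rewrite ltr_wpDl.
have fc x y : `|f x - f y| <= c * `|x - y|.
  by rewrite (le_trans (fL _ _))// ler_wpM2r// (le_trans (ler_norm L))// lerDl.
have cf := continuous_lipschitz fL.
pose g0 x := (c * x + f x) / (2 * c); pose h0 x := (c * x - f x) / (2 * c).
have nd_g : nondecreasing g0.
  move=> x y xy; rewrite ler_wpM2r ?invr_ge0 ?mulr_ge0 ?(ltW c0)//.
  have := fc x y; rewrite distrC ler_norml => /andP[+ _].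
  by rewrite (distrC x) (ger0_norm (_ : 0 <= y - x)) ?subr_ge0//; lra.
have nd_h : nondecreasing h0.
  move=> x y xy; rewrite ler_wpM2r ?invr_ge0 ?mulr_ge0 ?(ltW c0)//.
  have := fc y x; rewrite ler_norml => /andP[_ +].
  by rewrite (ger0_norm (_ : 0 <= y - x)) ?subr_ge0//; lra.
have cg : continuous g0.
  by move=> x; apply: cvgMl; apply: cvgD; [apply: cvgMr; exact: cvg_id|exact: cf].
have ch : continuous h0.
  by move=> x; apply: cvgMl; apply: cvgB; [apply: cvgMr; exact: cvg_id|exact: cf].
pose g : cumulative R R := HB.pack g0
  (isCumulative.Build R _ R g0 nd_g (right_continuousW cg)).
pose h : cumulative R R := HB.pack h0
  (isCumulative.Build R _ R h0 nd_h (right_continuousW ch)).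
have := @ae_derivable_stieltjes g h.
have gh (x y : R) : g x - g y + (h x - h y) = x - y.
  by rewrite /= /g0 /h0; field; rewrite gt_eqF.
move=> /(_ gh); apply: filterS; first exact: (ae_filter_ringOfSetsType mu).
move=> x dg.
rewrite (_ : f = (2 * c) \*: (g : R -> R) - c \*: id).
  by apply: derivableB; apply: derivableZ.
by apply/funext => y; rewrite !fctE /= /g0 /GRing.scale /=; field; rewrite gt_eqF.
Qed.
End rademacher.

(** * Integration, densities and independence *)

Lemma le_norm_bounded_fun T (R : realType) (c : R) (f : T -> R) :
  (forall x, `|f x| <= c) -> bounded_fun f.
Proof.
move=> fc; exists c; split=> [|M cM x _]; first exact: num_real.
exact: le_trans (fc x) (ltW cM).
Qed.

Lemma bounded_integrable d (T : measurableType d) (R : realType)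
    (P : probability T R) (f : T -> R) :
  measurable_fun setT f -> bounded_fun f -> P.-integrable setT (EFin \o f).
Proof.
move=> mf bf; apply: measurable_bounded_integrable => //.
exact: le_lt_trans (probability_le1 P measurableT) (ltry _).
Qed.

Lemma bounded_fun_comp T U (R : realType) (f : U -> R) (g : T -> U) :
  bounded_fun f -> bounded_fun (f \o g).
Proof. by case=> M [Mr HM]; exists M; split => // x Mx y _; exact: HM. Qed.

Section integral_off_null.
Context d (T : measurableType d) (R : realType) (mu : {measure set T -> \bar R}).
Variable N : set T.
Hypotheses (mN : measurable N) (N0 : mu N = 0%E).

Import HBNNSimple.

Lemma ge0_le_integral_off_null (f g : T -> \bar R) :
  (forall x, 0 <= f x)%E -> (forall x, 0 <= g x)%E -> (forall x, ~ N x -> f x = g x) ->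
  (\int[mu]_x f x <= \int[mu]_x g x)%E.
Proof.
move=> f0 g0 fg; rewrite !ge0_integralTE//.
apply: ub_ereal_sup => _ [h /= hf <-].
apply: ereal_sup_ubound; exists (proj_nnsfun h (measurableC mN)) => /=.
  move=> x; change (((h x) * \1_(~` N) x)%:E <= g x)%E; rewrite indicE.
  have [xN|xN] := boolP (x \in ~` N).
    by rewrite mulr1 -fg ?hf//; exact: set_mem xN.
  by rewrite mulr0 g0.
rewrite -!integralT_nnsfun; apply: ge0_ae_eq_integral => //.
- exact/measurable_EFinP.
- exact/measurable_EFinP.
- by move=> x _; rewrite lee_fin.
- by move=> x _; rewrite lee_fin.
- exists N; split=> // x /= H; apply: contrapT => xN; apply: H => _.
  change ((h x * \1_(~` N) x)%:E = (h x)%:E).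
  by rewrite indicE mem_set// mulr1.
Qed.

(* No measurability is required of f: the pointwise derivative of a Lipschitz
   function has an arbitrary value where the difference quotients diverge. *)
Lemma eq_integral_off_null (f g : T -> \bar R) :
  (forall x, ~ N x -> f x = g x) -> (\int[mu]_x f x = \int[mu]_x g x)%E.
Proof.
move=> fg; rewrite integralE [RHS]integralE.
by congr (_ - _)%E; apply/eqP; rewrite eq_le; apply/andP; split;
  apply: ge0_le_integral_off_null => // x xN; rewrite ?(funeposE, funenegE) fg.
Qed.
End integral_off_null.

Lemma integral_density d (T : measurableType d) (R : realType)
    (mu : {finite_measure set T -> \bar R}) (la : {sigma_finite_measure set T -> \bar R})
    (h f : T -> R) :
  measurable_fun setT h ->
  (forall A, measurable A -> mu A = (\int[la]_(x in A) (h x)%:E)%E) ->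
  mu.-integrable setT (EFin \o f) ->
  (\int[mu]_x (f x)%:E = \int[la]_x (f x * h x)%:E)%E.
Proof.
move=> mh muE intf.
have mula : mu `<< la.
  apply/null_content_dominatesP => A mA A0; rewrite muE//.
  by apply: null_set_integral => //; apply/measurable_funTS/measurable_EFinP.
rewrite -(Radon_Nikodym_change_of_variables mula measurableT intf).
apply: ae_eq_integral => //.
- apply: emeasurable_funM; first exact: measurable_int intf.
  by apply: measurable_int; exact: Radon_Nikodym_integrable.
- apply/measurable_EFinP; apply: measurable_funM => //.
  by apply/measurable_EFinP; exact: measurable_int intf.
- rewrite [X in ae_eq _ _ _ X](_ : _ = (EFin \o f) \* (EFin \o h))%E//.
  apply: ae_eqe_mul2l.
  apply: integral_ae_eq => //.
  + exact: Radon_Nikodym_integrable.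
  + exact/measurable_EFinP.
  + by move=> E _ mE; rewrite -Radon_Nikodym_integral//; exact: muE.
Qed.

Lemma is_derive_Rintegral d (Y : measurableType d) (R : realType)
    (mu : {measure set Y -> \bar R}) (f df : R -> Y -> R) (G : Y -> R) (a : R) :
  (forall x, mu.-integrable setT (EFin \o f x)) ->
  (forall (x : R) y, is_derive x 1 (f ^~ y) (df x y)) ->
  mu.-integrable setT (EFin \o G) ->
  (forall x y, `|x - a| < 1 -> `|df x y| <= G y) ->
  is_derive a 1 (fun x => \int[mu]_y f x y) (\int[mu]_y df a y).
Proof.
move=> intf fdf intG dfG.
have dE x y : derive1 (f ^~ y) x = df x y by have [_ <-] := fdf x y; rewrite derive1E.
have Ia : `]a - 1, a + 1[%classic a by rewrite /= in_itv /= ltrBlDr !ltrDl ltr01.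
have intf' (x : R) : `]a - 1, a + 1[%classic x -> mu.-integrable setT (EFin \o f x) by [].
have der' (x : R) (y : Y) : `]a - 1, a + 1[%classic x -> setT y -> derivable (f ^~ y) x 1.
  by move=> _ _; have [] := fdf x y.
have G0 y : 0 <= G y by rewrite (le_trans (normr_ge0 _) (dfG a y _))// subrr normr0.
have Gub (x : R) (y : Y) : `]a - 1, a + 1[%classic x -> setT y -> `|derive1 (f ^~ y) x| <= G y.
  by rewrite /= in_itv /= => xa _; rewrite dE dfG// ltr_distl.
have D := derivable_under_integral measurableT Ia intf' der' G0 intG Gub.
have E := differentiation_under_integral measurableT Ia intf' der' G0 intG Gub.
apply: DeriveDef => //; rewrite -derive1E E.
by apply: eq_Rintegral => y _; rewrite /partial1of2 dE.
Qed.

Lemma lebesgue_measure_translate (R : realType) (x : R) (A : set R) : measurable A ->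
  lebesgue_measure ((fun y => x + y) @^-1` A) = lebesgue_measure A.
Proof.
move=> mA.
have mt : measurable_fun setT (fun y : measurableTypeR R => (x + y : measurableTypeR R)).
  by apply: measurable_funD; [exact: measurable_cst|exact: measurable_id].
pose t : {mfun measurableTypeR R >-> measurableTypeR R} :=
  HB.pack (fun y => x + y) (isMeasurableFun.Build _ _ _ _ _ mt).
have H := fun m => @lebesgue_measure_unique R (pushforward lebesgue_measure t) m.
apply/esym; refine (H mt _ A mA).
move=> X /ocitvP [->|[[a b] /= /ltW ab ->]].
  by rewrite !measure0.
rewrite /= /pushforward.
have -> : t @^-1` `]a, b]%classic = `]a - x, b - x]%classic.
  by apply/seteqP; split => z /=; rewrite !in_itv /= ltrBlDl lerBrDl.
by rewrite !lebesgue_measure_itv /= !lte_fin ltrD2r -!EFinB (_ : b - x - (a - x) = b - a)//; ring.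
Qed.

Section independence.
Context d (T : measurableType d) (R : realType) (P : probability T R) (X Y : {RV P >-> R}).
Hypothesis XY : independent_RVs X Y.

Let mXY : measurable_fun setT (fun w => (X w, Y w)).
Proof. by apply/measurable_fun_pairP; split => /=; exact: measurable_funP. Qed.

Let joint : {RV P >-> (R * R)%type} :=
  HB.pack (fun w => (X w, Y w)) (isMeasurableFun.Build _ _ _ _ _ mXY).

Lemma joint_distribution (A : set (R * R)) : measurable A ->
  P [set w | A (X w, Y w)] = (distribution P X \x distribution P Y)%E A.
Proof.
move=> mA; apply/esym.
apply: (@product_measure_unique _ _ _ _ _ (distribution P X) (distribution P Y)
  (distribution P joint)) => // B C mB mC.
Qed.

Lemma integral_joint (f : R * R -> R) :
  measurable_fun setT f -> bounded_fun f ->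
  (\int[P]_w (f (X w, Y w))%:E =
   \int[distribution P X]_x \int[distribution P Y]_y (f (x, y))%:E)%E.
Proof.
move=> mf bf.
have intf : (distribution P X \x distribution P Y)%E.-integrable setT (EFin \o f).
  apply: measurable_bounded_integrable => //.
  have := @product_measure1E _ _ _ _ R (distribution P X) (distribution P Y) _ _
    measurableT measurableT.
  rewrite setXTT => H; apply: (@le_lt_trans _ _ (1 * 1)%E); last by rewrite mule1 ltry.
  rewrite [leLHS]H; apply: lee_pmul => //.
    exact: (@probability_le1 _ _ _ (distribution P X)).
  exact: (@probability_le1 _ _ _ (distribution P Y)).
rewrite (integral12_prod_meas1 intf).
rewrite (eq_measure_integral (distribution P joint)); last first.
  by move=> A mA _; exact: esym (joint_distribution mA).
rewrite integral_distribution//; first exact/measurable_EFinP.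
by apply: bounded_integrable; [exact: measurableT_comp|exact: bounded_fun_comp].
Qed.

Lemma expectation_indep_mul (f g : R -> R) :
  measurable_fun setT f -> (forall x, `|f x| <= 1) ->
  measurable_fun setT g -> (forall x, `|g x| <= 1) ->
  \int[P]_w (f (X w) * g (Y w)) = \int[P]_w f (X w) * \int[P]_w g (Y w).
Proof.
move=> mf f1 mg g1.
have bf := le_norm_bounded_fun f1; have bg := le_norm_bounded_fun g1.
have ib (U : {RV P >-> R}) (h : R -> R) : measurable_fun setT h -> bounded_fun h ->
    (distribution P U).-integrable setT (EFin \o h).
  exact: (@bounded_integrable _ _ _ (distribution P U)).
have dE (U : {RV P >-> R}) (h : R -> R) : measurable_fun setT h -> bounded_fun h ->
    \int[P]_w h (U w) = fine (\int[distribution P U]_x (h x)%:E)%E.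
  move=> mh bh; rewrite /Rintegral integral_distribution//; first exact/measurable_EFinP.
  by apply: bounded_integrable; [exact: measurableT_comp|exact: bounded_fun_comp].
rewrite (dE X)// (dE Y)// /Rintegral (@integral_joint (fun z => f z.1 * g z.2)); last 2 first.
- apply: measurable_funM; first exact: (measurableT_comp mf measurable_fst).
  exact: (measurableT_comp mg measurable_snd).
- apply: (@le_norm_bounded_fun _ _ 1) => z.
  by rewrite normrM mulr_ile1.
have gfin : (\int[distribution P Y]_y (g y)%:E)%E \is a fin_num.
  by apply: integrable_fin_num => //; exact: ib.
under eq_integral => x _.
  rewrite [X in integral _ _ X](_ : _ = (fun y => (f x)%:E * (g y)%:E)%E); last first.
    by apply/funext => y; rewrite EFinM.
  rewrite integralZl//; last exact: ib.
  rewrite -(fineK gfin).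
  over.
rewrite /= integralZr//; last exact: ib.
by rewrite fineM//; apply: integrable_fin_num => //; exact: ib.
Qed.

Lemma indep_add_null (N : set R) :
  (forall A, measurable A -> lebesgue_measure A = 0%E -> distribution P Y A = 0%E) ->
  measurable N -> lebesgue_measure N = 0%E -> P [set w | N (X w + Y w)] = 0%E.
Proof.
move=> Yac mN N0.
have mA : measurable [set z : R * R | N (z.1 + z.2)].
  rewrite -[X in measurable X]setTI.
  by apply: (@measurable_funD _ _ _ setT fst snd) => //; exact: measurableT.
rewrite (@joint_distribution _ mA) /product_measure1; apply: integral0_eq => x _ /=.
apply: Yac; first exact: measurable_xsection.
rewrite (_ : xsection _ _ = (fun y => x + y) @^-1` N); last first.
  by apply/seteqP; split => y; rewrite /xsection /= inE.
by rewrite lebesgue_measure_translate.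
Qed.
End independence.

(** * Levy measures *)

Section derive_trig_mul.
Variable R : realType.

Lemma is_derive_mull (u t : R) : is_derive t 1 (fun y => y * u) u.
Proof. by apply: is_derive_eq; rewrite /GRing.scale /=; ring. Qed.

Lemma is_derive_sin_mull (u t : R) : is_derive t 1 (fun y => sin (y * u)) (u * cos (t * u)).
Proof.
have := @is_derive1_comp R sin (fun y : R => y * u) t _ _ (is_derive_sin _) (is_derive_mull u t).
by rewrite mulrC.
Qed.

Lemma is_derive_cos_mull (u t : R) : is_derive t 1 (fun y => cos (y * u)) (- (u * sin (t * u))).
Proof.
have := @is_derive1_comp R cos (fun y : R => y * u) t _ _ (is_derive_cos _) (is_derive_mull u t).
by rewrite mulrC mulrN.
Qed.
End derive_trig_mul.

Section levy_integrability.
Variables (R : realType) (nu : {measure set R -> \bar R}).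
Hypothesis nu_levy : levy_measure nu.
Hypothesis nu_tail : (\int[nu]_(u in [set u : R | (1 < `|u|)%R]) (u ^+ 2)%:E < +oo)%E.

Lemma measurable_norm_gt1 : measurable [set u : R | 1 < `|u|].
Proof.
have mN : measurable_fun setT (fun u : R => `|u|).
  by apply: continuous_measurable_fun => x; exact: norm_continuous.
rewrite -[X in measurable X]setTI.
have := @measurable_fun_ltr _ _ _ setT (cst 1) (fun u : R => `|u|) (measurable_cst _) mN.
by move=> /(_ measurableT [set true]); apply.
Qed.

Lemma levy_indicE (u : R) : (\1_[set v : R | `|v| <= 1] u : R) = (`|u| <= 1)%R%:R.
Proof.
rewrite indicE; congr (_%:R); congr nat_of_bool.
by apply/idP/idP; rewrite inE.
Qed.

Lemma levy_sqr_integrable : nu.-integrable setT (EFin \o (fun u => u ^+ 2)).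
Proof.
have m2 : measurable_fun setT (fun u : R => u ^+ 2) by exact: measurable_funX.
apply/integrableP; split; first exact/measurable_EFinP.
have mA := measurable_norm_gt1.
have m2E : measurable_fun setT (fun u : R => (u ^+ 2)%:E) by exact/measurable_EFinP.
have mmin : measurable_fun setT (fun u : R => Num.min 1 (u ^+ 2)).
  exact: measurable_minr.
apply: (@le_lt_trans _ _ (\int[nu]_u (Num.min 1 (u ^+ 2))%:E +
   \int[nu]_(u in [set u : R | (1 < `|u|)%R]) (u ^+ 2)%:E)%E); last first.
  by rewrite lte_add_pinfty//; case: nu_levy.
rewrite [X in (_ <= _ + X)%E]integral_mkcond -ge0_integralD//; last 4 first.
- by move=> u _; rewrite lee_fin le_min ler01 sqr_ge0.
- exact/measurable_EFinP.
- by move=> u _; rewrite patchE; case: ifP => // _; rewrite lee_fin sqr_ge0.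
- exact: ((measurable_restrictT _ mA).1 (measurable_funTS m2E)).
apply: ge0_le_integral => //.
- by apply/measurable_EFinP; apply: measurableT_comp m2.
- apply: emeasurable_funD; first exact/measurable_EFinP.
  exact: ((measurable_restrictT _ mA).1 (measurable_funTS m2E)).
move=> u _; rewrite /= ger0_norm ?sqr_ge0// patchE.
case: ifPn => [_|]; first by rewrite -EFinD lee_fin lerDr le_min ler01 sqr_ge0.
rewrite notin_setE /= => /negP; rewrite -leNgt => u1.
by rewrite adde0 lee_fin le_min lexx andbT -real_normK ?num_real// exprn_ile1.
Qed.

Lemma levy_sqr_integrableZ (c : R) : nu.-integrable setT (EFin \o (fun u => c * u ^+ 2)).
Proof.
rewrite (_ : EFin \o _ = (fun u => c%:E * (EFin \o (fun u : R => (u ^+ 2)%R)) u)%E).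
  exact: integrableZl levy_sqr_integrable.
by apply/funext => u /=; rewrite EFinM.
Qed.

Lemma levy_integrable_le (c : R) (h : R -> R) : measurable_fun setT h ->
  (forall u, `|h u| <= c * u ^+ 2) -> nu.-integrable setT (EFin \o h).
Proof.
move=> mh hc; apply: (@le_integrable _ _ _ nu setT measurableT _ (EFin \o (fun u => c * u ^+ 2))).
- exact/measurable_EFinP.
- by move=> u _; rewrite lee_fin (le_trans (hc u))// ler_norm.
- exact: levy_sqr_integrableZ.
Qed.

Definition levy_exponent_re (t : R) : R := \int[nu]_u (cos (t * u) - 1).

Definition levy_exponent_im (b t : R) : R := t * b +
  \int[nu]_u (sin (t * u) - t * u * \1_[set v : R | `|v| <= 1] u).

Let mlin (t : R) : measurable_fun setT (fun u : R => t * u).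
Proof. exact: measurable_funM. Qed.

Let mcos (t : R) : measurable_fun setT (fun u : R => cos (t * u)).
Proof.
by apply: (measurableT_comp _ (mlin t)); apply: continuous_measurable_fun; exact: continuous_cos.
Qed.

Let msin (t : R) : measurable_fun setT (fun u : R => sin (t * u)).
Proof.
by apply: (measurableT_comp _ (mlin t)); apply: continuous_measurable_fun; exact: continuous_sin.
Qed.

Let mind : measurable_fun setT (\1_[set v : R | `|v| <= 1] : R -> R).
Proof.
apply: measurable_indic; rewrite (_ : [set v : R | _] = ~` [set u | 1 < `|u|]).
  by apply: measurableC; exact: measurable_norm_gt1.
by apply/seteqP; split => u /=; rewrite leNgt => /negP.
Qed.

Let normu_le_sqr (u : R) : 1 < `|u| -> `|u| <= u ^+ 2.
Proof. by move=> u1; rewrite -real_normK ?num_real// expr2 ler_peMl// ltW. Qed.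

Let sqr_ge1 (u : R) : 1 < `|u| -> 1 <= u ^+ 2.
Proof. by move=> u1; rewrite (le_trans (ltW u1))// normu_le_sqr. Qed.

Lemma levy_cosB1_integrable t : nu.-integrable setT (EFin \o (fun u => cos (t * u) - 1)).
Proof.
apply: (@levy_integrable_le (t ^+ 2)); first exact: measurable_funB.
by move=> u; rewrite -exprMn; exact: norm_cosB1_le2.
Qed.

Lemma levy_usin_le (t u : R) : `|u * sin (t * u)| <= `|t| * u ^+ 2.
Proof.
rewrite normrM -[u ^+ 2]real_normK ?num_real// expr2 mulrCA ler_wpM2l//.
by rewrite (le_trans (norm_sin_le _))// normrM.
Qed.

Lemma levy_usin_integrable t : nu.-integrable setT (EFin \o (fun u => u * sin (t * u))).
Proof.
by apply: (@levy_integrable_le `|t|); [exact: measurable_funM|exact: levy_usin_le].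
Qed.

Lemma levy_ucosB1_integrable t : nu.-integrable setT (EFin \o (fun u => u * (cos (t * u) - 1))).
Proof.
apply: (@levy_integrable_le `|t|) => [|u].
  by apply: measurable_funM => //; exact: measurable_funB.
rewrite normrM -[u ^+ 2]real_normK ?num_real// expr2 mulrCA ler_wpM2l//.
by rewrite (le_trans (norm_cosB1_le _))// normrM.
Qed.

Lemma levy_tail_integrable : nu.-integrable setT (EFin \o (id \_ [set u : R | 1 < `|u|])).
Proof.
apply: (@levy_integrable_le 1) => [|u].
  exact: ((measurable_restrictT id measurable_norm_gt1).1 (measurable_funTS (@measurable_id _ _ setT))).
rewrite mul1r patchE; case: ifPn => [|_]; last by rewrite normr0 sqr_ge0.
by rewrite inE /= => /normu_le_sqr.
Qed.

Lemma levy_sin_integrable t : nu.-integrable setT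
  (EFin \o (fun u => sin (t * u) - t * u * \1_[set v : R | `|v| <= 1] u)).
Proof.
apply: (@levy_integrable_le (t ^+ 2 + 1)) => [|u].
  by apply: measurable_funB => //; apply: measurable_funM.
rewrite levy_indicE; have [u1|u1] := leP `|u| 1.
  rewrite mulr1 (le_trans (norm_sinBid_le _))// exprMn mulrDl mul1r lerDl sqr_ge0//.
rewrite mulr0 subr0 (@le_trans _ _ 1)//; first by rewrite ler_norml sin_geN1 sin_le1.
rewrite (le_trans (sqr_ge1 u1))// mulrDl mul1r lerDr mulr_ge0 ?sqr_ge0//.
Qed.

Lemma is_derive_levy_exponent_re (t : R) :
  is_derive t 1 levy_exponent_re (- \int[nu]_u (u * sin (t * u))).
Proof.
rewrite -[X in is_derive _ _ _ X]mulN1r -RintegralZl//; last exact: levy_usin_integrable.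
apply: (@is_derive_Rintegral _ _ _ _ (fun t u => cos (t * u) - 1)
  (fun t u => -1 * (u * sin (t * u))) (fun u => (`|t| + 1) * u ^+ 2)).
- exact: levy_cosB1_integrable.
- move=> x u; rewrite mulN1r -[X in is_derive _ _ _ X]subr0.
  exact: is_deriveB (is_derive_cos_mull u x) (is_derive_cst (1 : R) x 1).
- exact: levy_sqr_integrableZ.
- move=> x u xt; rewrite mulN1r normrN (le_trans (levy_usin_le _ _))// ler_wpM2r ?sqr_ge0//.
  by rewrite -(subrK t x) (le_trans (ler_normD _ _))// addrC lerD2l ltW.
Qed.

Lemma is_derive_levy_exponent_im (b t : R) : is_derive t 1 (levy_exponent_im b)
  (b + \int[nu]_(u in [set u : R | 1 < `|u|]) u + \int[nu]_u (u * (cos (t * u) - 1))).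
Proof.
pose dg t (u : R) := u * cos (t * u) - u * \1_[set v : R | `|v| <= 1] u.
have dgE t' u : dg t' u = (id \_ [set u : R | 1 < `|u|]) u + u * (cos (t' * u) - 1).
  rewrite /dg levy_indicE patchE; have [u1|u1] := leP `|u| 1.
    rewrite memNset /=; last by rewrite ltNge u1.
    by rewrite mulr1 (_ : point = 0 :> R)//; ring.
  by rewrite mem_set// mulr0; ring.
rewrite -addrA Rintegral_mkcond -RintegralD//; last 2 first.
- exact: levy_tail_integrable.
- exact: levy_ucosB1_integrable.
under eq_Rintegral do rewrite -dgE.
have D : is_derive t 1 (fun t => \int[nu]_u (sin (t * u) - t * u * \1_[set v : R | `|v| <= 1] u))
    (\int[nu]_u dg t u).
  apply: (@is_derive_Rintegral _ _ _ _ (fun t u => sin (t * u) - t * u * \1_[set v : R | `|v| <= 1] u)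
    dg (fun u => (`|t| + 2) * u ^+ 2)).
  - exact: levy_sin_integrable.
  - move=> x u; rewrite /dg; set c := \1__ _.
    rewrite (_ : (fun x0 => _) = (fun y => sin (y * u)) - (fun y => y * (u * c))); last first.
      by apply/funext => y; rewrite !fctE mulrA.
    exact: is_deriveB (is_derive_sin_mull u x) (is_derive_mull (u * c) x).
  - exact: levy_sqr_integrableZ.
  - move=> x u xt; rewrite dgE.
    apply: (@le_trans _ _ (u ^+ 2 + `|x| * u ^+ 2)).
      rewrite (le_trans (ler_normD _ _))// lerD//.
        rewrite patchE; case: ifPn => [|_]; last by rewrite normr0 sqr_ge0.
        by rewrite inE /= => /normu_le_sqr.
      rewrite normrM -[u ^+ 2]real_normK ?num_real// expr2 mulrCA ler_wpM2l//.
      by rewrite (le_trans (norm_cosB1_le _))// normrM.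
    rewrite -[X in X + _]mul1r -mulrDl ler_wpM2r ?sqr_ge0//.
    rewrite -(subrK t x) (_ : `|t| + 2 = 1 + (1 + `|t|)); last by ring.
    by rewrite lerD2l (le_trans (ler_normD _ _))// lerD2r ltW.
exact: is_deriveD (is_derive_mull b t) D.
Qed.

Lemma levy_sigma_finite : sigma_finite setT nu.
Proof.
exists (fun n : nat => [set u : R | u = 0 \/ n.+1%:R^-1 <= u ^+ 2]).
  apply/seteqP; split => // u _ /=; have [->|u0] := eqVneq u 0; first by exists 0%N => //; left.
  have u20 : 0 < u ^+ 2 by rewrite exprn_even_gt0.
  exists (Num.truncn (u ^+ 2)^-1) => //; right.
  by rewrite invf_ple ?posrE ?ltr0n// ltW// truncnS_gt.
move=> n.
have mG : measurable [set u : R | n.+1%:R^-1 <= u ^+ 2].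
  rewrite -[X in measurable X]setTI.
  have := @measurable_fun_ler _ _ _ setT (cst n.+1%:R^-1) (fun u : R => u ^+ 2) (measurable_cst _).
  by move=> /(_ (@measurable_funX _ _ _ _ _ _ _))/(_ measurableT [set true]); apply.
split; first by apply: measurableU => //; exact: measurable_set1.
apply: (@le_lt_trans _ _ (nu ([set 0] `|` [set u : R | n.+1%:R^-1 <= u ^+ 2]))) => //.
apply: le_lt_trans (measureU2 nu (measurable_set1 0) mG) _.
have nu00 : nu [set 0] = 0%E by case: nu_levy.
rewrite [X in (X + _)%E]nu00 add0e.
have leG (u : R) : \1_[set u : R | n.+1%:R^-1 <= u ^+ 2] u <= n.+1%:R * u ^+ 2.
  rewrite indicE; case: (boolP (u \in _)) => [|_]; last by apply: mulr_ge0; rewrite ?sqr_ge0.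
  rewrite inE => /= uG; change (1 <= n.+1%:R * u ^+ 2).
  by rewrite mulrC -ler_pdivrMr// div1r.
have /integrableP[_] := levy_sqr_integrableZ n.+1%:R.
apply: le_lt_trans; set G := [set u | _] in mG *.
apply: (@le_trans _ _ (\int[nu]_u (\1_G u)%:E)%E); first by rewrite integral_indic// setIT.
apply: ge0_le_integral => //.
- by apply/measurable_EFinP; exact: measurable_indic.
- do 2 apply: measurableT_comp => //; apply: measurable_funM => //; exact: measurable_funX.
by move=> u _; apply: (le_trans _ (lee_abs _)); rewrite lee_fin.
Qed.
End levy_integrability.

Section levy_fubini.
Variables (R : realType) (nu : {sigma_finite_measure set R -> \bar R}).
Hypothesis nu_sqr : nu.-integrable setT (EFin \o (fun u => u ^+ 2)).
Local Notation mu := (@lebesgue_measure R).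

(* [levy_eta nu v] is the integral of [ker u v] in u, while [g v * ker u v] has
   Lebesgue integral [u * (H u - H 0)] in v when H' = g. *)
Let ker (u v : R) : R :=
  (if (0 < v) && (v <= u) then u else 0) + (if (v < 0) && (u <= v) then - u else 0).

Let ker_ge0 u v : 0 <= ker u v.
Proof.
rewrite /ker addr_ge0//.
  by case: ifPn => // /andP[v0 vu]; rewrite (le_trans (ltW v0)).
by case: ifPn => // /andP[v0 uv]; rewrite oppr_ge0 (le_trans uv)// ltW.
Qed.

Let measurable_ker : measurable_fun setT (fun z : R * measurableTypeR R => ker z.1 z.2).
Proof.
have m1 : measurable_fun setT (fun z : R * measurableTypeR R => z.1 : R) by exact: measurable_fst.
have m2 : measurable_fun setT (fun z : R * measurableTypeR R => z.2 : R) by exact: measurable_snd.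
apply: measurable_funD; apply: measurable_fun_ifT => //.
- by apply: measurable_and; [exact: measurable_fun_ltr|exact: measurable_fun_ler].
- by apply: measurable_and; [exact: measurable_fun_ltr|exact: measurable_fun_ler].
- exact: measurableT_comp.
Qed.

Let measurable_kerl v : measurable_fun setT (ker ^~ v).
Proof. exact: (measurableT_comp measurable_ker (measurable_pair2 v)). Qed.

Let ker_integrable v : nu.-integrable setT (EFin \o ker ^~ v).
Proof.
have [->|v0] := eqVneq v 0.
  rewrite (_ : _ \o _ = cst 0%E); first exact: integrable0.
  by apply/funext => u /=; rewrite /ker ltxx /= addr0.
have i2 : nu.-integrable setT (EFin \o (fun u => `|v|^-1 * u ^+ 2)).
  rewrite (_ : EFin \o _ = (fun u => (`|v|^-1)%:E * (EFin \o (fun u : R => (u ^+ 2)%R)) u)%E).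
    exact: integrableZl.
  by apply/funext => u /=; rewrite EFinM.
apply: le_integrable i2 => //; first exact/measurable_EFinP.
move=> u _; rewrite lee_fin ger0_norm// [leRHS]ger0_norm; last by rewrite mulr_ge0 ?invr_ge0 ?sqr_ge0.
rewrite ler_pdivlMl ?normr_gt0// /ker.
case: ifPn => [/andP[vp vu]|_].
  by rewrite (ltNge v 0) (ltW vp) /= addr0 gtr0_norm//; nra.
case: ifPn => [/andP[vn uv]|_]; last by rewrite addr0 mulr0 sqr_ge0.
by rewrite add0r ltr0_norm//; nra.
Qed.

Lemma levy_eta_ker v : levy_eta nu v = \int[nu]_u ker u v.
Proof.
rewrite /levy_eta /eta_plus /eta_minus !indicE Rintegral_mkcond [X in _ + X * _]Rintegral_mkcond.
have [v0|v0|<-] := ltgtP 0 v.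
- rewrite mem_set /= ?in_itv /= ?v0// memNset /=; last by rewrite in_itv /= (ltNge v) (ltW v0).
  rewrite mulr1 mulr0 addr0; apply: eq_Rintegral => u _.
  rewrite /ker v0 (ltNge v) (ltW v0) /= addr0 patchE.
  have [vu|vu] := leP v u; first by rewrite mem_set //= in_itv /= vu.
  by rewrite memNset //= in_itv /= andbT leNgt vu.
- rewrite memNset /=; last by rewrite in_itv /= (ltNge 0) (ltW v0).
  rewrite mem_set /= ?in_itv //= mulr1 mulr0 add0r; apply: eq_Rintegral => u _.
  rewrite /ker v0 (ltNge 0) (ltW v0) /= add0r patchE.
  have [uv|uv] := leP u v; first by rewrite mem_set //= in_itv /= uv.
  by rewrite memNset //= in_itv /= leNgt uv.
- rewrite !memNset /= ?in_itv /= ?ltxx// !mulr0 addr0.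
  rewrite /ker; under eq_Rintegral do rewrite ltxx /= addr0.
  by rewrite Rintegral_cst// mul0r.
Qed.

Lemma measurable_levy_eta : measurable_fun setT (levy_eta nu).
Proof.
rewrite (_ : levy_eta nu = fun v => fine (\int[nu]_u (ker u v)%:E)%E).
  apply: measurableT_comp => //.
  have mk : measurable_fun setT (EFin \o (fun z : R * measurableTypeR R => ker z.1 z.2)).
    exact/measurable_EFinP.
  by apply: (measurable_fun_fubini_tonelli_G _ mk) => z; rewrite lee_fin.
by apply/funext => v; rewrite levy_eta_ker.
Qed.

Let ftc (g H : R -> R) (a b : R) : a <= b -> continuous g ->
  (forall x : R, is_derive x 1 H (g x)) ->
  (\int[mu]_(v in `[a, b]) (g v)%:E = (H b - H a)%:E)%E.
Proof.
rewrite le_eqVlt => /orP[/eqP ->|ab] cg Hg.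
  by rewrite set_itv1 integral_set1 subrr.
have cH : continuous H.
  by move=> x; apply: differentiable_continuous; apply/derivable1_diffP; have [] := Hg x.
rewrite (@continuous_FTC2 _ g H)// ?EFinB//.
- exact: continuous_subspaceT.
- split; [by move=> x _; have [] := Hg x|exact: cvg_at_right_filter (cH a)|exact: cvg_at_left_filter (cH b)].
- by move=> x _; rewrite derive1E; have [_ ->] := Hg x.
Qed.

Lemma integral_kerr (g H : R -> R) (u : R) : continuous g ->
  (forall x : R, is_derive x 1 H (g x)) ->
  (\int[mu]_v (g v * ker u v)%:E = (u * (H u - H 0))%:E)%E.
Proof.
move=> cg Hg; have mg : measurable_fun setT g by exact: continuous_measurable_fun.
have mgE (D : set (measurableTypeR R)) : measurable_fun D (EFin \o g).
  by apply: measurable_funTS; exact/measurable_EFinP.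
have ig a b : mu.-integrable `[a, b]%classic (EFin \o g).
  apply: continuous_compact_integrable; first exact: segment_compact.
  exact: continuous_subspaceT.
have [u0|u0|<-] := ltgtP 0 u.
- transitivity (\int[mu]_(v in `]0%R, u]) (u * g v)%:E)%E.
    rewrite [RHS]integral_mkcond; apply: eq_integral => v _; rewrite patchE /ker.
    have -> : (v < 0) && (u <= v) = false.
      by apply/negbTE; rewrite negb_and -leNgt -ltNge; case: (leP 0 v) => //= v0; rewrite (lt_trans v0).
    rewrite addr0; case: ifPn => [vu|vu]; first by rewrite mem_set /= ?in_itv// mulrC.
    by rewrite memNset ?mulr0//= in_itv /=; exact/negP.
  rewrite (integral_itv_obnd_cbnd (r := 0)).
    transitivity (\int[mu]_(v in `[0%R, u]) (u%:E * (g v)%:E))%E.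
      by apply: eq_integral => v _; rewrite EFinM.
    by rewrite integralZl ?(ftc (ltW u0) cg Hg)//; exact: ig.
  by apply: measurable_funTS; apply/measurable_EFinP; exact: measurable_funM.
- transitivity (\int[mu]_(v in `[u, 0%R[) (- u * g v)%:E)%E.
    rewrite [RHS]integral_mkcond; apply: eq_integral => v _; rewrite patchE /ker.
    have -> : (0 < v) && (v <= u) = false.
      by apply/negbTE; rewrite negb_and -leNgt -ltNge; case: (leP v 0) => //= v0; rewrite (lt_trans u0).
    rewrite add0r andbC; case: ifPn => [vu|vu]; first by rewrite mem_set /= ?in_itv// mulrC.
    by rewrite memNset ?mulr0//= in_itv /=; exact/negP.
  rewrite (integral_itv_bndo_bndc (r := 0)).
    transitivity (\int[mu]_(v in `[u, 0%R]) ((- u)%:E * (g v)%:E))%E.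
      by apply: eq_integral => v _; rewrite EFinM.
    rewrite [LHS]integralZl//.
    rewrite (ftc (ltW u0) cg Hg).
    by rewrite -EFinM; congr EFin; ring.
  by apply: measurable_funTS; apply/measurable_EFinP; exact: measurable_funM.
- rewrite mul0r; apply: integral0_eq => v _; rewrite /ker.
  by rewrite !(ltNge _ v) !(ltNge v) !andNb addr0 mulr0.
Qed.

Lemma integral_levy_eta (g H : R -> R) (c : R) : continuous g ->
  (forall x, `|g x| <= c) -> (forall x : R, is_derive x 1 H (g x)) ->
  (\int[mu]_v (g v * levy_eta nu v)%:E = \int[nu]_u (u * (H u - H 0))%:E)%E.
Proof.
move=> cg gc Hg; have mg : measurable_fun setT g by exact: continuous_measurable_fun.
pose F (z : R * measurableTypeR R) := (g z.2 * ker z.1 z.2)%:E.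
have mF : measurable_fun setT F.
  apply/measurable_EFinP/measurable_funM => //.
  exact: (measurableT_comp mg measurable_snd).
have iF : (nu \x mu)%E.-integrable setT F.
  have := (@integrable12ltyP _ _ _ _ R nu mu F mF).2; apply.
  apply: (@le_lt_trans _ _ (\int[nu]_u (c * u ^+ 2)%:E)%E).
    apply: ge0_le_integral => //.
    - by move=> u _; apply: integral_ge0.
    - by apply: (measurable_fun_fubini_tonelli_F (abse \o F)) => //=; exact: measurableT_comp.
    - by apply/measurable_EFinP; apply: measurable_funM => //; exact: measurable_funX.
    move=> u _.
    have idD (x : R) : is_derive x 1 (fun y => c * y) c.
      by apply: is_derive_eq; rewrite /GRing.scale /=; ring.
    have := @integral_kerr (cst c) (fun y => c * y) u (@cst_continuous _ _ _) idD.
    rewrite mulr0 subr0 (_ : u * (c * u) = c * u ^+ 2); last by ring.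
    move=> <-; apply: ge0_le_integral => //.
    - by apply: measurableT_comp => //; exact: (measurableT_comp mF (measurable_pair1 u)).
    - apply/measurable_EFinP; apply: measurable_funM => //.
      exact: (measurableT_comp measurable_ker (measurable_pair1 u)).
    move=> v _; rewrite /F lee_fin /= normrM (ger0_norm (ker_ge0 _ _)) ler_wpM2r//.
  have /integrableP[_] : nu.-integrable setT (fun u => c%:E * (EFin \o (fun u : R => (u ^+ 2)%R)) u)%E.
    exact: integrableZl.
  apply: le_lt_trans; apply: ge0_le_integral => //.
  - by move=> u _; rewrite lee_fin mulr_ge0 ?sqr_ge0// (le_trans (normr_ge0 _) (gc 0)).
  - by apply/measurable_EFinP; apply: measurable_funM => //; exact: measurable_funX.
  - apply: measurableT_comp => //; apply: measurable_funeM.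
    by apply/measurable_EFinP; exact: measurable_funX.
  by move=> u _; rewrite /= lee_fin ler_norm.
have := Fubini iF; rewrite /F /= => FE.
transitivity (\int[mu]_v \int[nu]_u (g v * ker u v)%:E)%E.
  apply: eq_integral => v _.
  rewrite (eq_integral (fun u => (g v)%:E * (ker u v)%:E)%E); last by move=> u _; rewrite EFinM.
  rewrite integralZl//; last exact: ker_integrable.
  rewrite EFinM; congr (_ * _)%E; rewrite levy_eta_ker /Rintegral fineK//.
  by apply: integrable_fin_num => //; exact: ker_integrable.
rewrite -FE; apply: eq_integral => u _; exact: integral_kerr.
Qed.
End levy_fubini.

(** * Characteristic functions *)

(* The derivative of (c + i s) exp (- (p + i q)) vanishes. *)
Lemma exp_ode (R : realType) (c s p q dp dq : R -> R) :
  (forall t : R, is_derive t 1 p (dp t)) -> (forall t : R, is_derive t 1 q (dq t)) ->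
  (forall t : R, is_derive t 1 c (c t * dp t - s t * dq t)) ->
  (forall t : R, is_derive t 1 s (s t * dp t + c t * dq t)) ->
  c 0 = 1 -> s 0 = 0 -> p 0 = 0 -> q 0 = 0 ->
  forall t, c t = expR (p t) * cos (q t) /\ s t = expR (p t) * sin (q t).
Proof.
move=> dpt dqt dct dst c0 s0 p0 q0.
have dE (t : R) : is_derive t 1 (expR \o (- p)) (- dp t * expR (- p t)).
  rewrite mulrC; exact: (@is_derive1_comp R expR (- p) t _ _ (is_derive_expR _) (is_deriveN (dpt t))).
have dC (t : R) : is_derive t 1 (cos \o q) (- (dq t * sin (q t))).
  rewrite mulrC -mulNr; exact: (@is_derive1_comp R cos q t _ _ (is_derive_cos _) (dqt t)).
have dS (t : R) : is_derive t 1 (sin \o q) (dq t * cos (q t)).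
  rewrite mulrC; exact: (@is_derive1_comp R sin q t _ _ (is_derive_sin _) (dqt t)).
pose A := (expR \o (- p)) * (c * (cos \o q) + s * (sin \o q)).
pose B := (expR \o (- p)) * (s * (cos \o q) - c * (sin \o q)).
have dA (t : R) : is_derive t 1 A 0.
  have D := is_deriveM (dE t) (is_deriveD (is_deriveM (dct t) (dC t)) (is_deriveM (dst t) (dS t))).
  by apply: (is_derive_eq D); rewrite /GRing.scale /= !fctE; ring.
have dB (t : R) : is_derive t 1 B 0.
  have D := is_deriveM (dE t) (is_deriveB (is_deriveM (dst t) (dC t)) (is_deriveM (dct t) (dS t))).
  by apply: (is_derive_eq D); rewrite /GRing.scale /= !fctE; ring.
have A1 t : A t = 1.
  have -> : A t = A 0 by apply: is_derive_0_is_cst; exact: dA.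
  rewrite /A !fctE p0 q0 oppr0 expR0 cos0 sin0 c0 s0; ring.
have B0 t : B t = 0.
  have -> : B t = B 0 by apply: is_derive_0_is_cst; exact: dB.
  rewrite /B !fctE p0 q0 oppr0 expR0 cos0 sin0 c0 s0; ring.
move=> t; have := A1 t; have := B0 t; rewrite /A /B !fctE => {}B0 {}A1.
have ep : expR (p t) * expR (- p t) = 1 by rewrite expRxMexpNx_1.
have cs : cos (q t) ^+ 2 + sin (q t) ^+ 2 = 1 by exact: cos2Dsin2.
have A2 : c t * cos (q t) + s t * sin (q t) = expR (p t).
  by rewrite -[LHS]mul1r -ep -mulrA A1 mulr1.
have B2 : s t * cos (q t) - c t * sin (q t) = 0.
  by rewrite -[LHS]mul1r -ep -mulrA B0 mulr0.
split.
  rewrite -[LHS]mulr1 -cs -A2.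
  have -> : c t * (cos (q t) ^+ 2 + sin (q t) ^+ 2) =
    (c t * cos (q t) + s t * sin (q t)) * cos (q t) -
    (s t * cos (q t) - c t * sin (q t)) * sin (q t) by ring.
  by rewrite B2 mul0r subr0.
rewrite -[LHS]mulr1 -cs -A2.
have -> : s t * (cos (q t) ^+ 2 + sin (q t) ^+ 2) =
  (c t * cos (q t) + s t * sin (q t)) * sin (q t) +
  (s t * cos (q t) - c t * sin (q t)) * cos (q t) by ring.
by rewrite B2 mul0r addr0.
Qed.

Lemma EFin_Rintegral d (T : measurableType d) (R : realType)
    (mu : {measure set T -> \bar R}) (f : T -> R) :
  mu.-integrable setT (EFin \o f) -> (\int[mu]_x f x)%:E = (\int[mu]_x (f x)%:E)%E.
Proof. by move=> intf; rewrite fineK//; exact: integrable_fin_num. Qed.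

Lemma cexp_iR (R : realType) (r : R) : (cexp ('i * r%:C) = cos r +i* sin r)%C.
Proof.
rewrite /cexp; have -> : complex.Re ('i * r%:C)%C = 0 by rewrite /=; ring.
have -> : complex.Im ('i * r%:C)%C = r by rewrite /=; ring.
by rewrite expR0; apply/eqP; rewrite eq_complex; apply/andP; split; apply/eqP; rewrite /=; ring.
Qed.

Lemma is_IDP d (T : measurableType d) (R : realType) (P : probability T R)
    (X : T -> R) (b : R) (nu : {measure set R -> \bar R}) :
  is_ID P X b nu <-> forall t,
    \int[P]_w cos (t * X w) = expR (levy_exponent_re nu t) * cos (levy_exponent_im nu b t) /\
    \int[P]_w sin (t * X w) = expR (levy_exponent_re nu t) * sin (levy_exponent_im nu b t).
Proof.
have E t : cintegral P (fun w => cexp ('i * (t * X w)%:C)%C) =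
    (\int[P]_w cos (t * X w) +i* \int[P]_w sin (t * X w))%C.
  by rewrite /cintegral; congr (_ +i* _)%C; apply: eq_Rintegral => w _; rewrite cexp_iR.
have F t : cexp ('i * (t * b)%:C + cintegral nu (fun u => cexp ('i * (t * u)%:C) - 1
      - 'i * (t * u * \1_[set v : R | (`|v| <= 1)%R] u)%:C))%C =
    (expR (levy_exponent_re nu t) * cos (levy_exponent_im nu b t) +i*
     (expR (levy_exponent_re nu t) * sin (levy_exponent_im nu b t)))%C.
  rewrite /cintegral.
  have -> : \int[nu]_x complex.Re (cexp ('i * (t * x)%:C) - 1 - 'i * (t * x * \1_[set v : R | (`|v| <= 1)%R] x)%:C)%C =
      levy_exponent_re nu t.
    by apply: eq_Rintegral => u _; rewrite cexp_iR /=; ring.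
  have -> : \int[nu]_x complex.Im (cexp ('i * (t * x)%:C) - 1 - 'i * (t * x * \1_[set v : R | (`|v| <= 1)%R] x)%:C)%C =
      levy_exponent_im nu b t - t * b.
    rewrite /levy_exponent_im addrAC subrr add0r.
    by apply: eq_Rintegral => u _; rewrite cexp_iR /=; ring.
  rewrite /cexp /=.
  rewrite (_ : 0 * (t * b) - 1 * 0 + _ = levy_exponent_re nu t); last by ring.
  rewrite (_ : 0 * 0 + 1 * (t * b) + _ = levy_exponent_im nu b t); last by ring.
  by congr (_ +i* _)%C; ring.
split=> [H t|H t].
  by have := H t; rewrite E F => -[-> ->].
by rewrite E F; have [-> ->] := H t.
Qed.

Section covariance_identity.
Variables (R : realType) (d : measure_display) (T : measurableType d).
Variables (P : probability T R) (X : {RV P >-> R}).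
Hypothesis X2 : ('E_P[fun w => (X w ^+ 2)%R] < +oo)%E.

Lemma RV_integrable : P.-integrable setT (EFin \o X).
Proof.
have mX : measurable_fun setT X by exact: measurable_funP.
have i2 : P.-integrable setT (EFin \o (fun w => X w ^+ 2)).
  apply/integrableP; split; first by apply/measurable_EFinP; exact: measurable_funX.
  move: X2; rewrite unlock; apply: le_lt_trans; rewrite le_eqVlt; apply/orP; left; apply/eqP.
  by apply: eq_integral => w _; rewrite /= ger0_norm ?sqr_ge0.
have i1 : P.-integrable setT (EFin \o (fun=> 1 : R)).
  by apply: bounded_integrable => //; apply: (@le_norm_bounded_fun _ _ 1) => w; rewrite normr1.
apply: (@le_integrable _ _ _ P setT measurableT _ (EFin \o (fun w => 1 + X w ^+ 2))).
- exact/measurable_EFinP.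
- move=> w _; rewrite lee_fin [leRHS]ger0_norm ?addr_ge0 ?sqr_ge0//.
  rewrite -[X w ^+ 2]real_normK ?num_real//; have := sqr_ge0 (`|X w| - 1).
  move: `|X w| (normr_ge0 (X w)) => y y0; rewrite !expr2; nra.
- by rewrite (_ : EFin \o _ = (EFin \o (fun=> (1 : R)%R)) \+ (EFin \o (fun w => (X w ^+ 2)%R)))%E//; exact: integrableD.
Qed.

Lemma RV_mul_integrable (f : R -> R) : measurable_fun setT f -> bounded_fun f ->
  P.-integrable setT (EFin \o (fun w => X w * f (X w))).
Proof.
move=> mf bf; rewrite (_ : EFin \o _ = (EFin \o X) \* (EFin \o (f \o X)))%E.
  apply: integrableMl => //; first exact: RV_integrable.
    exact: measurableT_comp.
  exact: bounded_fun_comp.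
by apply/funext => w; rewrite /= EFinM.
Qed.

Lemma covariance_bounded (f : R -> R) : measurable_fun setT f -> bounded_fun f ->
  covariance P X (f \o X) =
  (\int[P]_w ((X w - fine 'E_P[X]%E) * f (X w))%:E)%E.
Proof.
move=> mf bf.
have iX := RV_integrable.
have ifX : P.-integrable setT (EFin \o (f \o X)).
  by apply: bounded_integrable; [exact: measurableT_comp|exact: bounded_fun_comp].
have iXf := RV_mul_integrable mf bf.
rewrite covarianceE; last 3 first.
- by apply/Lfun1_integrable.
- by apply/Lfun1_integrable.
- by apply/Lfun1_integrable.
rewrite unlock.
rewrite [RHS](_ : _ = \int[P]_w ((X w * f (X w))%:E - (fine (\int[P]_w (X w)%:E))%:E * (f (X w))%:E))%E; last first.
  by apply: eq_integral => w _; rewrite mulrBl EFinB EFinM.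
rewrite integralB//; last exact: integrableZl.
rewrite integralZl// fineK//.
exact: integrable_fin_num.
Qed.

Lemma is_derive_chf_cos (t : R) :
  is_derive t 1 (fun t => \int[P]_w cos (t * X w)) (- \int[P]_w (X w * sin (t * X w))).
Proof.
have mX : measurable_fun setT X by exact: measurable_funP.
have mc s : measurable_fun setT (fun x : R => cos (s * x)).
  apply: (measurableT_comp (f := cos)); last exact: measurable_funM.
  by apply: continuous_measurable_fun; exact: continuous_cos.
have ms s : measurable_fun setT (fun x : R => sin (s * x)).
  apply: (measurableT_comp (f := sin)); last exact: measurable_funM.
  by apply: continuous_measurable_fun; exact: continuous_sin.
have bs s : bounded_fun (fun x : R => sin (s * x)).
  by apply: (@le_norm_bounded_fun _ _ 1) => x; rewrite ler_norml sin_geN1 sin_le1.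
rewrite -[X in is_derive _ _ _ X]mulN1r -RintegralZl//; last exact: (RV_mul_integrable (ms t) (bs t)).
apply: (@is_derive_Rintegral _ _ _ _ (fun t w => cos (t * X w))
  (fun t w => -1 * (X w * sin (t * X w))) (fun w => `|X w|)).
- move=> s; apply: bounded_integrable; first exact: (measurableT_comp (mc s)).
  by apply: (@le_norm_bounded_fun _ _ 1) => x; rewrite ler_norml cos_geN1 cos_le1.
- by move=> s w; rewrite mulN1r; exact: is_derive_cos_mull.
- exact: (integrable_norm RV_integrable).
- move=> s w _; rewrite mulN1r normrN normrM ler_piMr//.
  by rewrite ler_norml sin_geN1 sin_le1.
Qed.

Lemma is_derive_chf_sin (t : R) :
  is_derive t 1 (fun t => \int[P]_w sin (t * X w)) (\int[P]_w (X w * cos (t * X w))).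
Proof.
have mX : measurable_fun setT X by exact: measurable_funP.
have ms s : measurable_fun setT (fun x : R => sin (s * x)).
  apply: (measurableT_comp (f := sin)); last exact: measurable_funM.
  by apply: continuous_measurable_fun; exact: continuous_sin.
apply: (@is_derive_Rintegral _ _ _ _ (fun t w => sin (t * X w))
  (fun t w => X w * cos (t * X w)) (fun w => `|X w|)).
- move=> s; apply: bounded_integrable; first exact: (measurableT_comp (ms s)).
  by apply: (@le_norm_bounded_fun _ _ 1) => x; rewrite ler_norml sin_geN1 sin_le1.
- by move=> s w; exact: is_derive_sin_mull.
- exact: (integrable_norm RV_integrable).
- move=> s w _; rewrite normrM ler_piMr//.
  by rewrite ler_norml cos_geN1 cos_le1.
Qed.
End covariance_identity.

(** * The covariance identity *)

(* Fubini's theorem requires a canonical sigma-finite structure on the measure. *)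
Section sigma_finite_version.
Context d (T : measurableType d) (R : realType) (nu : {measure set T -> \bar R}).

Definition sigma_finite_version (sf : sigma_finite setT nu) : set T -> \bar R := nu.

Variable sf : sigma_finite setT nu.

HB.instance Definition _ := isMeasure.Build _ _ _ (sigma_finite_version sf)
  (measure0 nu) (measure_ge0 nu) (@measure_semi_sigma_additive _ _ _ nu).

HB.instance Definition _ :=
  @Measure_isSigmaFinite.Build _ _ _ (sigma_finite_version sf) sf.
End sigma_finite_version.

Section stein_identity.
Variables (R : realType) (d : measure_display) (T : measurableType d).
Variables (P : probability T R) (X Y : {RV P >-> R}) (nu : {measure set R -> \bar R}).
Hypothesis X2 : ('E_P[fun w => (X w ^+ 2)%R] < +oo)%E.
Hypothesis nu_levy : levy_measure nu.
Hypothesis nu_tail : (\int[nu]_(u in [set u : R | (1 < `|u|)%R]) (u ^+ 2)%:E < +oo)%E.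
Hypothesis XY : independent_RVs X Y.
Hypothesis Y_law : forall A : set R, measurable A ->
  distribution P Y A =
  (\int[lebesgue_measure]_(u in A) (levy_eta nu u / second_moment nu)%:E)%E.

Local Notation s := (second_moment nu).
Local Notation m := (fine 'E_P[X]%E).
Let Di (t : R) : R := \int[nu]_u (u * sin (t * u)).
Let Dr (t : R) : R := \int[nu]_u (u * (cos (t * u) - 1)).
Let C (t : R) : R := \int[P]_w cos (t * X w).
Let S (t : R) : R := \int[P]_w sin (t * X w).

Let mcos (t : R) : measurable_fun setT (fun x : R => cos (t * x)).
Proof.
apply: (measurableT_comp (f := cos)); last exact: measurable_funM.
by apply: continuous_measurable_fun; exact: continuous_cos.
Qed.

Let msin (t : R) : measurable_fun setT (fun x : R => sin (t * x)).
Proof.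
apply: (measurableT_comp (f := sin)); last exact: measurable_funM.
by apply: continuous_measurable_fun; exact: continuous_sin.
Qed.

Let cos1 (x : R) : `|cos x| <= 1. Proof. by rewrite ler_norml cos_geN1 cos_le1. Qed.
Let sin1 (x : R) : `|sin x| <= 1. Proof. by rewrite ler_norml sin_geN1 sin_le1. Qed.

Let nu' : {sigma_finite_measure set R -> \bar R} :=
  sigma_finite_version (levy_sigma_finite nu_levy nu_tail).

Let eta_ge0 v : 0 <= levy_eta nu v.
Proof.
have := @levy_eta_ker R nu' v; rewrite -[levy_eta nu' v]/(levy_eta nu v) => ->.
apply: Rintegral_ge0 => u _; apply: addr_ge0.
  by case: ifPn => // /andP[v0 vu]; rewrite (le_trans (ltW v0)).
by case: ifPn => // /andP[v0 uv]; rewrite oppr_ge0 (le_trans uv)// ltW.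
Qed.

Let measurable_eta : measurable_fun setT (fun v => levy_eta nu v / s).
Proof.
apply: measurable_funM => //.
exact: (@measurable_levy_eta R nu').
Qed.

(* Were s = 0, the junk value x / 0 = 0 would make the law of Y vanish. *)
Let s_neq0 : s != 0.
Proof.
apply/negP => /eqP s0; have := Y_law measurableT.
rewrite integral0_eq; last by move=> u _; rewrite s0 invr0 mulr0.
move/eqP; rewrite (@probability_setT _ _ _ (distribution P Y)).
by rewrite onee_eq0.
Qed.

Let s_ge0 : 0 <= s. Proof. by apply: Rintegral_ge0 => u _; exact: sqr_ge0. Qed.

Lemma Y_abs_continuous A : measurable A -> lebesgue_measure A = 0%E -> distribution P Y A = 0%E.
Proof.
move=> mA A0; rewrite Y_law//; apply: null_set_integral => //.
by apply: measurable_funTS; apply/measurable_EFinP; exact: measurable_eta.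
Qed.

Lemma integral_law_Y (g H : R -> R) (c : R) : continuous g ->
  (forall x, `|g x| <= c) -> (forall x : R, is_derive x 1 H (g x)) ->
  s * \int[P]_w g (Y w) = \int[nu]_u (u * (H u - H 0)).
Proof.
move=> cg gc Hg; have mg : measurable_fun setT g by exact: continuous_measurable_fun.
have bg := le_norm_bounded_fun gc.
have iY : (distribution P Y).-integrable setT (EFin \o g).
  exact: (@bounded_integrable _ _ _ (distribution P Y)).
have ieta : (@lebesgue_measure R).-integrable setT (EFin \o (fun v => levy_eta nu v / s)).
  apply/integrableP; split; first by apply/measurable_EFinP; exact: measurable_eta.
  apply: (@le_lt_trans _ _ (distribution P Y setT)).
    rewrite Y_law//; apply: ge0_le_integral => //.
    - by apply: measurableT_comp => //; apply/measurable_EFinP; exact: measurable_eta.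
    - by apply/measurable_EFinP; exact: measurable_eta.
    - by move=> v _; rewrite lee_fin ger0_norm// divr_ge0.
  exact: le_lt_trans (@probability_le1 _ _ _ (distribution P Y) _ measurableT) (ltry _).
have igeta : (@lebesgue_measure R).-integrable setT (EFin \o (fun v => g v * (levy_eta nu v / s))).
  rewrite (_ : EFin \o _ = (EFin \o g) \* (EFin \o (fun v => levy_eta nu v / s)%R))%E.
    exact: integrableMr.
  by apply/funext => v; rewrite /= EFinM.
have -> : \int[P]_w g (Y w) = \int[lebesgue_measure]_v (g v * (levy_eta nu v / s)).
  rewrite /Rintegral; congr fine.
  have mY : measurable_fun setT (Y : T -> measurableTypeR R) by exact: (measurable_funP Y).
  pose Y' : {RV P >-> measurableTypeR R} := HB.pack (Y : T -> measurableTypeR R)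
    (isMeasurableFun.Build _ _ _ _ _ mY).
  have iY' : (distribution P Y').-integrable setT (EFin \o (g : measurableTypeR R -> R)).
    exact: (@bounded_integrable _ _ _ (distribution P Y') g mg bg).
  have Y'_law (A : set (measurableTypeR R)) : measurable A -> distribution P Y' A =
    (\int[lebesgue_measure]_(u in A) (levy_eta nu u / s)%:E)%E by exact: Y_law.
  rewrite -[RHS](@integral_density _ (measurableTypeR R) R (distribution P Y') lebesgue_measure
    (fun v => levy_eta nu v / s) g measurable_eta Y'_law iY').
  rewrite [RHS](@integral_distribution _ _ _ _ _ P Y')//; first exact/measurable_EFinP.
  by apply: bounded_integrable; [exact: measurableT_comp|exact: bounded_fun_comp].
rewrite -RintegralZl//; congr fine.
rewrite -[RHS](@integral_levy_eta R nu' (levy_sqr_integrable nu_levy nu_tail) g H c)//.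
apply: eq_integral => v _; congr EFin.
by rewrite -[levy_eta nu' v]/(levy_eta nu v); field.
Qed.

Lemma law_Y_cos t : s * (t * \int[P]_w cos (t * Y w)) = Di t.
Proof.
have := @integral_law_Y (fun v => t * cos (v * t)) (fun v => sin (v * t)) `|t|.
rewrite mul0r sin0 => H.
rewrite -RintegralZl//; last first.
  apply: bounded_integrable; first exact: (measurableT_comp (mcos t)).
  by apply: (@le_norm_bounded_fun _ _ 1) => w; exact: cos1.
rewrite (_ : \int[P]_w _ = \int[P]_w (t * cos (Y w * t))); last first.
  by apply: eq_Rintegral => w _; rewrite (mulrC t (Y w)).
have H1 : continuous (fun v : R => t * cos (v * t)).
  move=> v; apply: cvgMr; apply: (@continuous_cvg _ _ _ _ _ _ (@cos R)); first exact: continuous_cos.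
  by apply: cvgMl; exact: cvg_id.
have H2 (v : R) : `|t * cos (v * t)| <= `|t| by rewrite normrM ler_piMr.
rewrite (H H1 H2 (is_derive_sin_mull t)).
by apply: eq_Rintegral => u _; rewrite subr0 (mulrC u t).
Qed.

Lemma law_Y_sin t : s * (t * \int[P]_w sin (t * Y w)) = - Dr t.
Proof.
have := @integral_law_Y (fun v => t * sin (v * t)) (fun v => - cos (v * t)) `|t|.
rewrite mul0r cos0 => H.
rewrite -RintegralZl//; last first.
  apply: bounded_integrable; first exact: (measurableT_comp (msin t)).
  by apply: (@le_norm_bounded_fun _ _ 1) => w; exact: sin1.
rewrite (_ : \int[P]_w _ = \int[P]_w (t * sin (Y w * t))); last first.
  by apply: eq_Rintegral => w _; rewrite (mulrC t (Y w)).
have H1 : continuous (fun v : R => t * sin (v * t)).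
  move=> v; apply: cvgMr; apply: (@continuous_cvg _ _ _ _ _ _ (@sin R)); first exact: continuous_sin.
  by apply: cvgMl; exact: cvg_id.
have H2 (v : R) : `|t * sin (v * t)| <= `|t| by rewrite normrM ler_piMr.
have H3 (v : R) : is_derive v 1 (fun v => - cos (v * t)) (t * sin (v * t)).
  by rewrite -[X in is_derive _ _ _ X]opprK; exact: is_deriveN (is_derive_cos_mull t v).
rewrite (H H1 H2 H3) -[RHS]mulN1r -RintegralZl//; last exact: levy_ucosB1_integrable.
by apply: eq_Rintegral => u _; rewrite (mulrC u t); ring.
Qed.

Let int_prod (f g : R -> R) : measurable_fun setT f -> (forall x, `|f x| <= 1) ->
  measurable_fun setT g -> (forall x, `|g x| <= 1) ->
  P.-integrable setT (EFin \o (fun w => f (X w) * g (Y w))).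
Proof.
move=> mf f1 mg g1; apply: bounded_integrable.
  by apply: measurable_funM; exact: measurableT_comp.
by apply: (@le_norm_bounded_fun _ _ 1) => w; rewrite normrM mulr_ile1.
Qed.

Lemma integral_sin_add t : \int[P]_w sin (t * (X w + Y w)) =
  S t * \int[P]_w cos (t * Y w) + C t * \int[P]_w sin (t * Y w).
Proof.
have i1 : P.-integrable setT (EFin \o (fun w => sin (t * X w) * cos (t * Y w))).
  exact: (int_prod (msin t) (fun x => sin1 (t * x)) (mcos t) (fun x => cos1 (t * x))).
have i2 : P.-integrable setT (EFin \o (fun w => cos (t * X w) * sin (t * Y w))).
  exact: (int_prod (mcos t) (fun x => cos1 (t * x)) (msin t) (fun x => sin1 (t * x))).
have <- := expectation_indep_mul XY (msin t) (fun x => sin1 (t * x)) (mcos t) (fun x => cos1 (t * x)).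
have <- := expectation_indep_mul XY (mcos t) (fun x => cos1 (t * x)) (msin t) (fun x => sin1 (t * x)).
rewrite -(RintegralD measurableT i1 i2).
by apply: eq_Rintegral => w _; rewrite mulrDr sinD.
Qed.

Lemma integral_cos_add t : \int[P]_w cos (t * (X w + Y w)) =
  C t * \int[P]_w cos (t * Y w) - S t * \int[P]_w sin (t * Y w).
Proof.
have i1 : P.-integrable setT (EFin \o (fun w => cos (t * X w) * cos (t * Y w))).
  exact: (int_prod (mcos t) (fun x => cos1 (t * x)) (mcos t) (fun x => cos1 (t * x))).
have i2 : P.-integrable setT (EFin \o (fun w => sin (t * X w) * sin (t * Y w))).
  exact: (int_prod (msin t) (fun x => sin1 (t * x)) (msin t) (fun x => sin1 (t * x))).
have <- := expectation_indep_mul XY (mcos t) (fun x => cos1 (t * x)) (mcos t) (fun x => cos1 (t * x)).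
have <- := expectation_indep_mul XY (msin t) (fun x => sin1 (t * x)) (msin t) (fun x => sin1 (t * x)).
rewrite -(RintegralB measurableT i1 i2).
by apply: eq_Rintegral => w _; rewrite mulrDr cosD.
Qed.

Lemma stein_rhs_cos t : s * (- t * \int[P]_w sin (t * (X w + Y w))) = - (S t * Di t) + C t * Dr t.
Proof.
rewrite integral_sin_add -(law_Y_cos t) -[Dr t]opprK -(law_Y_sin t); ring.
Qed.

Lemma stein_rhs_sin t : s * (t * \int[P]_w cos (t * (X w + Y w))) = C t * Di t + S t * Dr t.
Proof.
rewrite integral_cos_add -(law_Y_cos t) -[Dr t]opprK -(law_Y_sin t); ring.
Qed.

Let stein (f df : R -> R) : Prop :=
  (\int[P]_w ((X w - m) * f (X w))%:E = s%:E * \int[P]_w (df (X w + Y w))%:E)%E.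

Let int_X (f : R -> R) (c : R) : measurable_fun setT f -> (forall x, `|f x| <= c) ->
  P.-integrable setT (EFin \o (fun w => (X w - m) * f (X w))).
Proof.
move=> mf fc; have bf := le_norm_bounded_fun fc.
rewrite (_ : EFin \o _ = (EFin \o (fun w => (X w * f (X w))%R)) \-
  (fun w => m%:E * (EFin \o (f \o X)) w))%E; last first.
  by apply/funext => w; rewrite /= mulrBl EFinB EFinM.
apply: integrableB => //; first exact: (RV_mul_integrable X2).
apply: integrableZl => //.
by apply: bounded_integrable; [exact: measurableT_comp|exact: bounded_fun_comp].
Qed.

Let int_Z (f : R -> R) (c : R) : measurable_fun setT f -> (forall x, `|f x| <= c) ->
  P.-integrable setT (EFin \o (fun w => f (X w + Y w))).
Proof.
move=> mf fc; apply: bounded_integrable.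
  by apply: (measurableT_comp mf); exact: measurable_funD.
by apply: (@le_norm_bounded_fun _ _ c) => w; exact: fc.
Qed.

Let integral_Xm (f : R -> R) (c : R) : measurable_fun setT f -> (forall x, `|f x| <= c) ->
  \int[P]_w ((X w - m) * f (X w)) = \int[P]_w (X w * f (X w)) - m * \int[P]_w f (X w).
Proof.
move=> mf fc; have bf := le_norm_bounded_fun fc.
have i1 := RV_mul_integrable X2 mf bf.
have i2 : P.-integrable setT (EFin \o (f \o X)).
  by apply: bounded_integrable; [exact: measurableT_comp|exact: bounded_fun_comp].
rewrite -(RintegralZl m measurableT i2) -RintegralB//.
  by apply: eq_Rintegral => w _; rewrite mulrBl.
rewrite (_ : EFin \o _ = (fun w => m%:E * (EFin \o (f \o X)) w))%E; first exact: integrableZl.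
by apply/funext => w; rewrite /= EFinM.
Qed.

Lemma steinE (f df : R -> R) (c c' : R) : measurable_fun setT f -> (forall x, `|f x| <= c) ->
  measurable_fun setT df -> (forall x, `|df x| <= c') ->
  stein f df <-> \int[P]_w (X w * f (X w)) - m * \int[P]_w f (X w) = s * \int[P]_w df (X w + Y w).
Proof.
move=> mf fc mdf dfc; rewrite /stein -(integral_Xm mf fc).
rewrite -(EFin_Rintegral (int_X mf fc)) -(EFin_Rintegral (int_Z mdf dfc)) -EFinM.
by split => [[]|->].
Qed.

Let good (f : R -> R) : Prop := measurable_fun setT f /\ exists c, forall x, `|f x| <= c.

Lemma stein_add f df g dg : good f -> good df -> good g -> good dg ->
  stein f df -> stein g dg -> stein (f \+ g) (df \+ dg).
Proof.
move=> [mf [c fc]] [mdf [c1 dfc]] [mg [c2 gc]] [mdg [c3 dgc]] sf sg; rewrite /stein.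
under eq_integral do rewrite /= mulrDr EFinD.
under [in RHS]eq_integral do rewrite /= EFinD.
rewrite (integralD measurableT (int_X mf fc) (int_X mg gc)).
rewrite (integralD measurableT (int_Z mdf dfc) (int_Z mdg dgc)).
rewrite muleDr//; last first.
  by apply: fin_num_adde_defr; apply: (integrable_fin_num measurableT (int_Z mdf dfc)).
by congr (_ + _)%E.
Qed.

Lemma stein_scale k f df : good f -> good df ->
  stein f df -> stein (fun x => k * f x) (fun x => k * df x).
Proof.
move=> [mf [c fc]] [mdf [c1 dfc]] sf; rewrite /stein.
under eq_integral do rewrite mulrCA EFinM.
under [in RHS]eq_integral do rewrite EFinM.
rewrite (integralZl measurableT (int_X mf fc)).
rewrite (integralZl measurableT (int_Z mdf dfc)).
by rewrite muleCA; congr (_ * _)%E.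
Qed.

Let good_add f g : good f -> good g -> good (f \+ g).
Proof.
move=> [mf [c fc]] [mg [c2 gc]]; split; first exact: measurable_funD.
by exists (c + c2) => x; rewrite (le_trans (ler_normD _ _))// lerD.
Qed.

Let good_scale k f : good f -> good (fun x => k * f x).
Proof.
move=> [mf [c fc]]; split; first exact: measurable_funM.
by exists (`|k| * c) => x; rewrite normrM ler_wpM2l.
Qed.

Let good_cos t : good (fun x => cos (t * x)).
Proof. by split; [exact: mcos|exists 1 => x; exact: cos1]. Qed.

Let good_sin t : good (fun x => sin (t * x)).
Proof. by split; [exact: msin|exists 1 => x; exact: sin1]. Qed.

Lemma stein_cosE t : stein (fun x => cos (t * x)) (fun x => - t * sin (t * x)) <->
  \int[P]_w (X w * cos (t * X w)) - m * C t = - (S t * Di t) + C t * Dr t.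
Proof.
have [m1 [c1 b1]] := good_cos t; have [m2 [c2 b2]] := good_scale (- t) (good_sin t).
rewrite (steinE m1 b1 m2 b2) -stein_rhs_cos.
rewrite RintegralZl//; have [m3 [c3 b3]] := good_sin t; exact: (int_Z m3 b3).
Qed.

Lemma stein_sinE t : stein (fun x => sin (t * x)) (fun x => t * cos (t * x)) <->
  \int[P]_w (X w * sin (t * X w)) - m * S t = C t * Di t + S t * Dr t.
Proof.
have [m1 [c1 b1]] := good_sin t; have [m2 [c2 b2]] := good_scale t (good_cos t).
rewrite (steinE m1 b1 m2 b2) -stein_rhs_sin.
rewrite RintegralZl//; have [m3 [c3 b3]] := good_cos t; exact: (int_Z m3 b3).
Qed.

Section extension.
Hypothesis stein_cos : forall t, stein (fun x => cos (t * x)) (fun x => - t * sin (t * x)).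
Hypothesis stein_sin : forall t, stein (fun x => sin (t * x)) (fun x => t * cos (t * x)).

Lemma stein_trigpoly f df : trigpoly f df -> [/\ good f, good df & stein f df].
Proof.
elim=> [c t a|{}f {}df g dg _ [gf gdf sf] _ [gg gdg sg]]; last first.
  by split; [exact: good_add|exact: good_add|exact: stein_add].
have E1 : (fun x : R => c * cos (t * x + a)) =
    (fun x => (c * cos a) * cos (t * x)) \+ (fun x => (- (c * sin a)) * sin (t * x)).
  by apply/funext => x /=; rewrite cosD; ring.
have E2 : (fun x : R => - (c * t) * sin (t * x + a)) =
    (fun x => (c * cos a) * (- t * sin (t * x))) \+ (fun x => (- (c * sin a)) * (t * cos (t * x))).
  by apply/funext => x /=; rewrite sinD; ring.
have gc := good_cos t; have gs := good_sin t.
have gs' := good_scale (- t) gs; have gc' := good_scale t gc.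
rewrite E1 E2; split.
- by apply: good_add; exact: good_scale.
- by apply: good_add; exact: good_scale.
- by apply: stein_add; (do ?exact: good_scale); exact: stein_scale.
Qed.

Lemma stein_lipschitz (f : R -> R) (M L : R) : (forall x, `|f x| <= M) ->
  (forall x y, `|f x - f y| <= L * `|x - y|) -> stein f (derive1 f).
Proof.
move=> fM fL.
have mX : measurable_fun setT X by exact: measurable_funP.
have mZ : measurable_fun setT (fun w => X w + Y w) by exact: measurable_funD.
have [N [mN N0 dN]] := ae_derivable_lipschitz fL.
pose NZ := [set w | N (X w + Y w)].
have NZ0 : P NZ = 0%E by apply: (indep_add_null XY Y_abs_continuous).
have mNZ : measurable NZ by rewrite -[NZ]setTI; exact: mZ.
pose fi := trig_approx f; pose dfi := trig_approx' f.
have tp i : trigpoly (fi i) (dfi i) by exact: trigpoly_trig_approx.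
have mtp i : measurable_fun setT (fi i) /\ measurable_fun setT (dfi i).
  by have [[? _] [? _] _] := stein_trigpoly (tp i).
have fi_cvg x : fi i x @[i --> \oo] --> f x by exact: (cvg_trig_approx fL).
have cf := continuous_lipschitz fL.
have mf : measurable_fun setT f by exact: continuous_measurable_fun.
have mXm : measurable_fun setT (fun w => X w - m) by exact: measurable_funB.
have lim1 : (\int[P]_w ((X w - m) * fi i (X w))%:E @[i --> \oo] -->
    \int[P]_w ((X w - m) * f (X w))%:E)%E.
  have := @dominated_convergence _ _ _ P setT measurableT
    (fun i w => ((X w - m) * fi i (X w))%:E) (fun w => ((X w - m) * f (X w))%:E)
    (fun w => (`|X w - m| * M)%:E).
  case=> //.
  - move=> i; apply/measurable_EFinP; apply: measurable_funM => //.
    by apply: measurableT_comp => //; have [] := mtp i.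
  - by apply/measurable_EFinP; apply: measurable_funM => //; exact: measurableT_comp.
  - apply: aeW => w _; apply: cvg_EFin; first exact: nearW.
    by apply: cvgMr; exact: fi_cvg.
  - have iXm : P.-integrable setT (EFin \o (fun w => (X w - m) * M)).
      by apply: (int_X (f := cst M) (c := `|M|)).
    have := integrable_abse iXm; apply: eq_integrable => // w _ /=.
    by rewrite normrM (ger0_norm (le_trans (normr_ge0 _) (fM 0))).
  - apply: aeW => w i _; rewrite lee_fin normrM ler_wpM2l//.
    exact: norm_trig_approx_le.
have lim2 : (\int[P]_w (dfi i (X w + Y w))%:E @[i --> \oo] -->
    \int[P]_w (derive1 f (X w + Y w))%:E)%E.
  pose h i w := \1_(~` NZ) w * dfi i (X w + Y w).
  pose h0 w := \1_(~` NZ) w * derive1 f (X w + Y w).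
  have off w : ~ NZ w -> \1_(~` NZ) w = 1 :> R by move=> nw; rewrite indicE mem_set.
  have E i : (\int[P]_w (dfi i (X w + Y w))%:E = \int[P]_w (h i w)%:E)%E.
    by apply: (eq_integral_off_null mNZ NZ0) => w nw; rewrite /h off// mul1r.
  have E0 : (\int[P]_w (derive1 f (X w + Y w))%:E = \int[P]_w (h0 w)%:E)%E.
    by apply: (eq_integral_off_null mNZ NZ0) => w nw; rewrite /h0 off// mul1r.
  rewrite E0; under eq_fun do rewrite E.
  have mh i : measurable_fun setT (h i).
    apply: measurable_funM; first by apply: measurable_indic; exact: measurableC.
    by apply: measurableT_comp => //; have [] := mtp i.
  have hcvg w : h i w @[i --> \oo] --> h0 w.
    have [NZw|nw] := pselect (NZ w).
      have z : \1_(~` NZ) w = 0 :> R by rewrite indicE memNset//; exact.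
      rewrite /h0 z mul0r (_ : (fun i => h i w) = cst 0); first exact: cvg_cst.
      by apply/funext => i; rewrite /h z mul0r.
    apply: cvgMr; apply: (cvg_trig_approx' fL).
    have dw : derivable f (X w + Y w) 1.
      by apply: contrapT => nd; apply: nw; apply: dN.
    by rewrite derive1E; exact: DeriveDef.
  have mhE i : measurable_fun setT (fun w => (h i w)%:E) by apply/measurable_EFinP; exact: mh.
  have hcvgE w : (h i w)%:E @[i --> \oo] --> (h0 w)%:E.
    by apply: cvg_EFin; [exact: nearW|exact: hcvg].
  have := @dominated_convergence _ _ _ P setT measurableT
    (fun i w => (h i w)%:E) (fun w => (h0 w)%:E) (fun=> L%:E).
  case=> //.
  - apply: (emeasurable_fun_cvg (fun i w => (h i w)%:E)) => [i|w _]; [exact: mhE|exact: hcvgE].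
  - by apply: aeW => w _; exact: hcvgE.
  - have : P.-integrable setT (EFin \o cst L) by exact: finite_measure_integrable_cst.
    by [].
  - apply: aeW => w i _; rewrite lee_fin /h normrM (le_trans _ (norm_trig_approx'_le fL i (X w + Y w)))//.
    by rewrite ler_piMl// indicE; case: (_ \in _); rewrite ?normr1 ?normr0.
have lim3 : (s%:E * \int[P]_w (dfi i (X w + Y w))%:E @[i --> \oo] -->
    s%:E * \int[P]_w (derive1 f (X w + Y w))%:E)%E by exact: cvgeZl.
rewrite /stein; apply: (cvg_unique _ lim1) => //.
rewrite (_ : (fun i => \int[P]_w ((X w - m) * fi i (X w))%:E)%E =
  (fun i => s%:E * \int[P]_w (dfi i (X w + Y w))%:E)%E); last first.
  by apply/funext => i; have [] := stein_trigpoly (tp i).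
by apply: lim3.
Qed.
End extension.
End stein_identity.

Unset Implicit Arguments.

Theorem proposition3p1 (R : realType) (d : measure_display)
    (T : measurableType d) (P : probability T R) (X Y : {RV P >-> R})
    (b : R) (nu : {measure set R -> \bar R})
    (X_nondegenerate : nondegenerate_RV P X)
    (X_square_integrable : ('E_P[fun w => (X w ^+ 2)%R] < +oo)%E)
    (nu_levy : levy_measure nu)
    (nu_neq0 : nu setT != 0%E)
    (nu_tail : (\int[nu]_(u in [set u : R | (1 < `|u|)%R]) (u ^+ 2)%:E < +oo)%E)
    (XY_independent : independent_RVs X Y)
    (Y_law : forall A : set R, measurable A ->
       distribution P Y A =
       (\int[lebesgue_measure]_(u in A) (levy_eta nu u / second_moment nu)%:E)%E) :
  ((forall f : R -> R, bounded_fun f -> lipschitz f ->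
      covariance P X (f \o X) =
      ((second_moment nu)%:E * 'E_P[derive1 f \o (X \+ Y)%R])%E)
   /\ ('E_P[X] = (b + \int[nu]_(u in [set u : R | (1 < `|u|)%R]) u)%:E)%E)
  <-> is_ID P X b nu.
Proof.
set m0 := b + _.
pose C t := \int[P]_w cos (t * X w); pose S t := \int[P]_w sin (t * X w).
pose Di (t : R) := \int[nu]_u (u * sin (t * u)).
pose Dr (t : R) := \int[nu]_u (u * (cos (t * u) - 1)).
pose p := levy_exponent_re nu; pose q := levy_exponent_im nu b.
have EX : ('E_P[X] = (fine 'E_P[X])%:E)%E.
  rewrite fineK// unlock; apply: integrable_fin_num => //.
  exact: RV_integrable X_square_integrable.
have C0 : C 0 = 1.
  rewrite /C; under eq_Rintegral do rewrite mul0r cos0.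
  transitivity (1 * fine (P setT)); first exact: Rintegral_cst.
  by rewrite probability_setT mulr1.
have S0 : S 0 = 0.
  rewrite /S; under eq_Rintegral do rewrite mul0r sin0.
  by rewrite Rintegral_cst// mul0r.
have dC (t : R) := is_derive_chf_cos X_square_integrable t.
have dS (t : R) := is_derive_chf_sin X_square_integrable t.
have dp (t : R) : is_derive t 1 p (- Di t) by exact: is_derive_levy_exponent_re.
have dq (t : R) : is_derive t 1 q (m0 + Dr t) by exact: is_derive_levy_exponent_im.
have p0 : p 0 = 0.
  rewrite /p /levy_exponent_re; under eq_Rintegral do rewrite mul0r cos0 subrr.
  by rewrite Rintegral_cst// mul0r.
have q0 : q 0 = 0.
  rewrite /q /levy_exponent_im mul0r add0r.
  under eq_Rintegral do rewrite !mul0r sin0 subrr.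
  by rewrite Rintegral_cst// mul0r.
have SC t := stein_cosE X_square_integrable nu_levy nu_tail XY_independent Y_law t.
have SS t := stein_sinE X_square_integrable nu_levy nu_tail XY_independent Y_law t.
split=> [[cov mean]|/is_IDP H].
  apply/is_IDP.
  have m_m0 : fine 'E_P[X]%E = m0 by rewrite mean.
  have key (f df : R -> R) (c L : R) : (forall x, `|f x| <= c) -> (forall x, `|df x| <= L) ->
      (forall x : R, is_derive x 1 f (df x)) ->
      (\int[P]_w ((X w - fine 'E_P[X]) * f (X w))%:E =
       (second_moment nu)%:E * \int[P]_w (df (X w + Y w))%:E)%E.
    move=> fc dfL fdf; have fL := lipschitz_of_derive fdf dfL.
    have mf : measurable_fun setT f.
      by apply: continuous_measurable_fun; exact: continuous_lipschitz fL.
    have bf := le_norm_bounded_fun fc.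
    rewrite -(covariance_bounded X_square_integrable mf bf) cov//.
      congr (_ * _)%E; rewrite unlock; apply: eq_integral => w _ /=.
      by rewrite derive1E; have [_ ->] := fdf (X w + Y w).
    apply: (@klipschitzW _ _ _ L); first exact: (@globally_properfilter _ _ (0, 0)).
    by move=> [x y] _; exact: fL.
  have dcosr (t x : R) : is_derive x 1 (fun x => cos (t * x)) (- t * sin (t * x)).
    have -> : (fun x => cos (t * x)) = (fun x => cos (x * t)) by apply/funext => z; rewrite mulrC.
    by rewrite (mulrC t x) mulNr; exact: is_derive_cos_mull.
  have dsinr (t x : R) : is_derive x 1 (fun x => sin (t * x)) (t * cos (t * x)).
    have -> : (fun x => sin (t * x)) = (fun x => sin (x * t)) by apply/funext => z; rewrite mulrC.
    by rewrite (mulrC t x); exact: is_derive_sin_mull.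
  have cos1 (x : R) : `|cos x| <= 1 by rewrite ler_norml cos_geN1 cos_le1.
  have sin1 (x : R) : `|sin x| <= 1 by rewrite ler_norml sin_geN1 sin_le1.
  have Ic t : \int[P]_w (X w * cos (t * X w)) - m0 * C t = - (S t * Di t) + C t * Dr t.
    rewrite -m_m0; apply/SC.
    apply: (key (fun x => cos (t * x)) (fun x => - t * sin (t * x)) 1 `|t|) => // x.
    by rewrite normrM normrN ler_piMr.
  have Is t : \int[P]_w (X w * sin (t * X w)) - m0 * S t = C t * Di t + S t * Dr t.
    rewrite -m_m0; apply/SS.
    apply: (key (fun x => sin (t * x)) (fun x => t * cos (t * x)) 1 `|t|) => // x.
    by rewrite normrM ler_piMr.
  apply: (exp_ode dp dq _ _ C0 S0 p0 q0) => t.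
    apply: (is_derive_eq (dC t)); move/eqP: (Is t); rewrite subr_eq => /eqP ->.
    by ring.
  apply: (is_derive_eq (dS t)); move/eqP: (Ic t); rewrite subr_eq => /eqP ->.
  by ring.
have CE : C = (expR \o p) * (cos \o q) by apply/funext => t; exact: (H t).1.
have SE : S = (expR \o p) * (sin \o q) by apply/funext => t; exact: (H t).2.
have dE (t : R) := @is_derive1_comp R expR p t _ _ (is_derive_expR _) (dp t).
have dcq (t : R) := @is_derive1_comp R cos q t _ _ (is_derive_cos _) (dq t).
have dsq (t : R) := @is_derive1_comp R sin q t _ _ (is_derive_sin _) (dq t).
have Is (t : R) : \int[P]_w (X w * sin (t * X w)) = C t * Di t + S t * (m0 + Dr t).
  apply: oppr_inj; have [_ <-] := dC t; rewrite -/C CE; have [_ ->] := is_deriveM (dE t) (dcq t).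
  by rewrite SE /GRing.scale /= !fctE /=; ring.
have Ic (t : R) : \int[P]_w (X w * cos (t * X w)) = - (S t * Di t) + C t * (m0 + Dr t).
  have [_ <-] := dS t; rewrite -/S SE; have [_ ->] := is_deriveM (dE t) (dsq t).
  by rewrite CE /GRing.scale /= !fctE /=; ring.
have m_m0 : fine 'E_P[X]%E = m0.
  transitivity (\int[P]_w (X w * cos (0 * X w))).
    rewrite unlock; congr fine; apply: eq_integral => w _.
    by rewrite mul0r cos0 mulr1.
  rewrite Ic S0 C0 mul0r mul1r oppr0 add0r /Dr.
  under eq_Rintegral do rewrite mul0r cos0 subrr mulr0.
  by rewrite Rintegral_cst// mul0r addr0.
split; last by rewrite EX m_m0.
have stc t := (SC t).2; have sts t := (SS t).2.
move=> f bf lf.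
have [M _ fM] := pinfty_ex_gt (@real0 R) bf.
have [L _ fL] := pinfty_ex_gt (@real0 R) lf.
have {}fM x : `|f x| <= M by exact: fM.
have {}fL x y : `|f x - f y| <= L * `|x - y| by exact: (fL (x, y)).
have mf : measurable_fun setT f.
  by apply: continuous_measurable_fun; exact: continuous_lipschitz fL.
rewrite (covariance_bounded X_square_integrable mf (le_norm_bounded_fun fM)).
transitivity ((second_moment nu)%:E * \int[P]_w (derive1 f (X w + Y w))%:E)%E; last first.
  by congr (_ * _)%E; rewrite unlock.
apply: (stein_lipschitz X_square_integrable nu_levy nu_tail XY_independent Y_law _ _ fM fL) => t.
  apply: stc; rewrite m_m0 Ic -/(C t) -/(S t) -/(Di t) -/(Dr t); ring.
apply: sts; rewrite m_m0 Is -/(C t) -/(S t) -/(Di t) -/(Dr t); ring.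
Qed.
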